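(* Let $N\ge1$, let $C_r,C_b,C_{rr},C_{rb},C_{br},C_{bb}>0$ be constants, let $$D_r(p,q)=C_r e^{-C_{rr}p+C_{rb}q},\qquad D_b(p,q)=C_b e^{C_{br}p-C_{bb}q},$$ and let $K_1$ be an admissible kernel on $\mathbb{R}^N$. Then for every $(r_I,b_I)\in\overline{\mathcal{M}}$ the unique local solution $(r,b)$ of the system $$\partial_t r=(1-\rho)\,K_1*(D_r(r,b)\,r)-D_r(r,b)\,r\,K_1*(1-\rho),$$ $$\partial_t b=(1-\rho)\,K_1*(D_b(r,b)\,b)-D_b(r,b)\,b\,K_1*(1-\rho),$$ on $\mathbb{T}^N$, with $\rho=r+b$ and $r(\cdot,0)=r_I$, $b(\cdot,0)=b_I$, satisfies $(r(\cdot,t),b(\cdot,t))\in\overline{\mathcal{M}}$ and furthermore exists for arbitrary times $T>0$, i.e. it exists on $[0,T]$ for every $T>0$.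
   Context: $\mathbb{T}^N=\mathbb{R}^N/\mathbb{Z}^N$ is the $N$-dimensional torus; functions on it are identified with periodic functions on $\mathbb{R}^N$. For a kernel $K$ on $\mathbb{R}^N$ and a function $u$ on $\mathbb{T}^N$, $(K*u)(x)=\int_{\mathbb{R}^N}K(x-x')u(x')\,dx'$, where $u$ is extended periodically; convolutions act in the space variable only. The set $\mathcal{M}$ is $\{(r,b)\in L^2(\mathbb{T}^N)^2 : 0<r,\ 0<b,\ r+b<1 \text{ a.e.}\}$ and $\overline{\mathcal{M}}$ is its closure in $L^2(\mathbb{T}^N)^2$, i.e. the set of pairs with $r\ge 0$, $b\ge 0$, $r+b\le 1$ a.e.; in particular $\overline{\mathcal{M}}\subset L^\infty(\mathbb{T}^N)^2$. A kernel $K$ is admissible if: (K1) $K\in W^{1,1}(\mathbb{R}^N)$; (K2) $K$ is positive and radially symmetric, i.e. $K(x)=k(|x|)$, and $k$ is non-increasing; (K3) $k(|x|)$ is at most as singular as the Coulomb kernel as $|x|\to 0$, i.e. as $s\to 0^+$, $k(s)=O(s^{2-N})$ if $N\ge 3$, $k(s)=O(|\log s|)$ if $N=2$, $k(s)=O(1)$ if $N=1$. A solution on $[0,T]$ is a pair $(r,b)\in[C^1((0,T],L^\infty(\mathbb{T}^N))]^2$, continuous on $[0,T]$ with values in $L^\infty(\mathbb{T}^N)^2$, satisfying the system for $t\in(0,T]$ and attaining the initial data at $t=0$. ''The unique local solution'' is the solution of this kind, which for every such $(r_I,b_I)$ exists and is unique on some interval $[0,T]$ with $T>0$. *)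

(* Defs.v *)
From HB Require Import structures.
From mathcomp Require Import all_boot all_order all_algebra.
From mathcomp Require Import all_classical all_reals all_analysis.

Set Implicit Arguments.
Unset Strict Implicit.
Unset Printing Implicit Defensive.
Import Order.TTheory GRing.Theory Num.Theory.
Import numFieldNormedType.Exports.
Local Open Scope classical_set_scope.
Local Open Scope ring_scope.

Definition rV_display : measure_display -> measure_display.
Proof. exact. Qed.

(* Product sigma-algebra on row vectors; for T the reals with their Borel sets
   it is the Borel sigma-algebra of R^n. *)
Section measurable_rV.
Context {d} {T : measurableType d}.
Variable n : nat.

Let coors : 'I_n -> 'rV[T]_n -> T := fun i x => x ord0 i.

Let rV_set0 : g_sigma_preimage coors set0.
Proof. exact: sigma_algebra0. Qed.

Let rV_setC A : g_sigma_preimage coors A -> g_sigma_preimage coors (~` A).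
Proof. exact: sigma_algebraC. Qed.

Let rV_bigcup (F : _^nat) : (forall i, g_sigma_preimage coors (F i)) ->
  g_sigma_preimage coors (\bigcup_i (F i)).
Proof. exact: sigma_algebra_bigcup. Qed.

HB.instance Definition _ := @isMeasurable.Build (rV_display d)
  ('rV[T]_n) (g_sigma_preimage coors) rV_set0 rV_setC rV_bigcup.

Lemma measurable_coord (i : 'I_n) :
  measurable_fun [set: 'rV[T]_n] (fun x : 'rV[T]_n => x ord0 i).
Proof.
move=> _ Y mY; rewrite setTI; apply: sub_sigma_algebra => /=.
rewrite -bigcup_seq/=; exists i => /=; first by rewrite mem_index_enum.
by exists Y => //; rewrite setTI.
Qed.

Lemma measurable_fun_rV d' (S : measurableType d') (f : S -> 'rV[T]_n) :
  (forall i, measurable_fun [set: S] (fun s => f s ord0 i)) ->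
  measurable_fun [set: S] f.
Proof.
move=> mf _ A mA; rewrite setTI.
suff : (g_sigma_preimage coors : set (set _)) `<=`
    [set A | measurable (f @^-1` A)] by exact.
apply: smallest_sub.
  split => /=; first by rewrite preimage_set0.
  - by move=> B mB; rewrite setTD preimage_setC; exact: measurableC.
  - by move=> F mF; rewrite preimage_bigcup; exact: bigcup_measurable.
rewrite -bigcup_seq; apply: bigcup_sub => i _ _ [B mB <-] /=.
by rewrite setTI -[X in measurable X]setTI; exact: mf.
Qed.

End measurable_rV.

Section lebesgue_step.
Context {R : realType}.
Variable n : nat.

Definition consrV (p : R * 'rV[R]_n) : 'rV[R]_n.+1 :=
  \row_i oapp (p.2 ord0) p.1 (unlift ord0 i).

Definition unconsrV (x : 'rV[R]_n.+1) : R * 'rV[R]_n :=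
  (x ord0 ord0, \row_i x ord0 (lift ord0 i)).

Lemma consrVK : cancel consrV unconsrV.
Proof.
move=> [a v]; rewrite /unconsrV mxE unlift_none/=; congr pair.
by apply/rowP => i; rewrite !mxE liftK.
Qed.

Lemma measurable_consrV : measurable_fun setT consrV.
Proof.
apply: measurable_fun_rV => i; under eq_fun do rewrite mxE.
case: unliftP => [j _|_] /=; last exact: measurable_fst.
exact: (measurableT_comp (measurable_coord j)).
Qed.

Lemma measurable_unconsrV : measurable_fun setT unconsrV.
Proof.
apply/measurable_fun_pairP; split => /=; first exact: measurable_coord.
apply: measurable_fun_rV => i /=; under eq_fun do rewrite mxE.
exact: measurable_coord.
Qed.

Variable m : {sigma_finite_measure set 'rV[R]_n -> \bar R}.

Definition lebesgueS : set 'rV[R]_n.+1 -> \bar R :=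
  pushforward (@lebesgue_measure R \x m)%E consrV.

Let lebesgueS0 : lebesgueS set0 = 0%E.
Proof. by apply: measure0; exact: measurable_consrV. Qed.

Let lebesgueS_ge0 A : (0 <= lebesgueS A)%E.
Proof. by apply: measure_ge0; exact: measurable_consrV. Qed.

Let lebesgueS_sigma_additive : semi_sigma_additive lebesgueS.
Proof. by apply: measure_semi_sigma_additive; exact: measurable_consrV. Qed.

HB.instance Definition _ := isMeasure.Build _ _ _ lebesgueS
  lebesgueS0 lebesgueS_ge0 lebesgueS_sigma_additive.

Let lebesgueS_sigma_finite : sigma_finite setT lebesgueS.
Proof.
have /sigma_finiteP[F [UF ndF Foo]] := sigma_finiteT (@lebesgue_measure R).
have /sigma_finiteP[G [UG ndG Goo]] := sigma_finiteT m.
exists (fun i => unconsrV @^-1` (F i `*` G i)).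
  apply/esym; rewrite -subTset => x _.
  have [i _ Fi] : (\bigcup_i F i) (unconsrV x).1 by rewrite -UF.
  have [j _ Gj] : (\bigcup_i G i) (unconsrV x).2 by rewrite -UG.
  exists (maxn i j) => //; split.
    by move: Fi; exact/subsetPset/ndF/leq_maxl.
  by move: Gj; exact/subsetPset/ndG/leq_maxr.
move=> i; have [mF Fi] := Foo i; have [mG Gi] := Goo i; split.
  by rewrite -[X in measurable X]setTI; apply: measurable_unconsrV => //;
    exact: measurableX.
rewrite /lebesgueS /pushforward -comp_preimage (_ : _ \o _ = id); last first.
  exact/funext/consrVK.
by rewrite preimage_id product_measure1E// lte_mul_pinfty// ge0_fin_numE.
Qed.

HB.instance Definition _ := Measure_isSigmaFinite.Build _ _ _ lebesgueS
  lebesgueS_sigma_finite.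

End lebesgue_step.

Fixpoint lebesgue_rV (R : realType) n :
    {sigma_finite_measure set 'rV[R]_n -> \bar R} :=
  if n is k.+1 then lebesgueS (lebesgue_rV R k) else \d_(0 : 'rV[R]_0).

Lemma lebesgue_rV_box (R : realType) n (a b : 'rV[R]_n) :
  (forall i, a ord0 i <= b ord0 i) ->
  lebesgue_rV R n [set x | forall i, a ord0 i <= x ord0 i < b ord0 i] =
  (\prod_(i < n) (b ord0 i - a ord0 i))%:E.
Proof.
elim: n a b => [|n IH] a b ab.
  by rewrite big_ord0 /= diracE mem_set// => -[].
rewrite /= /lebesgueS /pushforward.
rewrite (_ : _ @^-1` _ = `[a ord0 ord0, b ord0 ord0[%classic `*`
    [set x : 'rV[R]_n | forall i, (unconsrV a).2 ord0 i <= x ord0 i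
                                    < (unconsrV b).2 ord0 i]); last first.
  apply/seteqP; split => [[x v] /= h|[x v] /= [h0 h] i].
    split; first by have := h ord0; rewrite mxE unlift_none /= in_itv.
    by move=> i; have := h (lift ord0 i); rewrite !mxE liftK.
  have [j ->|->] := unliftP ord0 i; last by move: h0; rewrite mxE unlift_none in_itv.
  by have := h j; rewrite !mxE liftK.
rewrite product_measure1E//.
  rewrite IH; last by move=> i; rewrite !mxE.
  rewrite big_ord_recl EFinM; congr (_ * _)%E.
    apply: etrans (lebesgue_measure_itv _) _ => /=; rewrite lte_fin.
    have := ab ord0; rewrite le_eqVlt => /predU1P[->|->]; last by rewrite EFinB.
    by rewrite ltxx subrr.
  by congr EFin; apply: eq_bigr => i _; rewrite !mxE.
rewrite (_ : mkset _ = \bigcap_(i in [set: 'I_n]) ((fun x : 'rV[R]_n => x ord0 i)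
   @^-1` `[(unconsrV a).2 ord0 i, (unconsrV b).2 ord0 i[%classic)); last first.
  by apply/seteqP; split => x /= h i; have := h i; rewrite /= in_itv/=; [|exact].
apply: fin_bigcap_measurable => // i _; rewrite -[X in measurable X]setTI.
exact: measurable_coord.
Qed.

Section kernels.
Context {R : realType} {N : nat}.
Implicit Types (K g phi : 'rV[R]_N -> R) (x : 'rV[R]_N).

(* The norm `|x| that the library puts on 'rV[R]_N is the sup norm. *)
Definition enorm x : R := Num.sqrt (\sum_i x ord0 i ^+ 2).

Definition partial (i : 'I_N) (phi : 'rV[R]_N -> R) : 'rV[R]_N -> R :=
  'D_(delta_mx ord0 i) phi.

Definition smooth phi : Prop := forall s : seq 'I_N,
  continuous (foldr partial phi s) /\
  forall i x, derivable (foldr partial phi s) x (delta_mx ord0 i).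

Definition test_function phi : Prop :=
  smooth phi /\ compact (closure [set x | phi x != 0]).

Definition weak_partial (i : 'I_N) K g : Prop :=
  forall phi, test_function phi ->
    \int[lebesgue_rV R N]_x (K x * partial i phi x) =
    - \int[lebesgue_rV R N]_x (g x * phi x).

Definition sobolev11 K : Prop :=
  K \in Lfun (lebesgue_rV R N) 1%:E /\
  forall i, exists2 g, g \in Lfun (lebesgue_rV R N) 1%:E & weak_partial i K g.

Definition coulomb (s : R) : R :=
  match N with
  | 0 | 1 => 1
  | 2 => `|ln s|
  | _ => (s ^+ (N - 2))^-1
  end.

(* k and K are unconstrained at the origin, where K may be singular. *)
Definition admissible K : Prop :=
  sobolev11 K /\
  exists k : R -> R,
    [/\ forall x, x != 0 -> K x = k (enorm x),
        forall s : R, 0 < s -> 0 < k s,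
        forall s s' : R, 0 < s -> s <= s' -> k s' <= k s &
        k =O_ (0^'+) coulomb].

End kernels.

Section torus.
Context {R : realType} {N : nat}.
Implicit Types (u v : 'rV[R]_N -> R) (w : R -> 'rV[R]_N -> R).
Implicit Types (p : \bar R) (A : set R).

Definition unit_cube : set 'rV[R]_N := [set x | forall i, 0 <= x ord0 i < 1].

Lemma measurable_unit_cube : measurable unit_cube.
Proof.
rewrite (_ : unit_cube = \bigcap_(i in [set: 'I_N])
  ((fun x : 'rV[R]_N => x ord0 i) @^-1` `[0, 1[%classic)); last first.
  by apply/seteqP; split => x /= h i; have := h i; rewrite /= in_itv/=; [|exact].
apply: fin_bigcap_measurable => // i _; rewrite -[X in measurable X]setTI.
exact: measurable_coord.
Qed.

(* Functions on the torus are Z^N-periodic functions on R^N, and the measure of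
   the torus is Lebesgue measure on a fundamental domain. Elements of L^p(T^N)
   are handled through representatives, so they are equal when they agree a.e. *)
Definition torus_measure : {measure set 'rV[R]_N -> \bar R} :=
  mrestr (lebesgue_rV R N) measurable_unit_cube.

Definition periodic u : Prop :=
  forall (x : 'rV[R]_N) (z : 'rV[int]_N), u (x + map_mx intr z) = u x.

Definition torusL p u : Prop := periodic u /\ u \in Lfun torus_measure p.

Definition torus_dist p u v : \bar R :=
  'N[torus_measure]_p[EFin \o (u \- v)%R]%E.

Definition phaseM : set (('rV[R]_N -> R) * ('rV[R]_N -> R)) :=
  [set rb | [/\ torusL 2%:E rb.1, torusL 2%:E rb.2 &
    \forall x \ae torus_measure,
      [/\ 0 < rb.1 x, 0 < rb.2 x & rb.1 x + rb.2 x < 1]]].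

Definition phaseMbar : set (('rV[R]_N -> R) * ('rV[R]_N -> R)) :=
  [set rb | [/\ torusL 2%:E rb.1, torusL 2%:E rb.2 &
    forall e : R, 0 < e -> exists2 rb', phaseM rb' &
      (torus_dist 2%:E rb.1 rb'.1 < e%:E)%E /\
      (torus_dist 2%:E rb.2 rb'.2 < e%:E)%E]].

Definition Linfty_continuous A w : Prop :=
  (forall t, A t -> torusL +oo%E (w t)) /\
  forall t, A t ->
    torus_dist +oo%E (w s) (w t) @[s --> within A (nbhs t)] --> 0%E.

(* w is differentiable from A to L^oo(T^N) with derivative w'; at an endpoint of
   A the difference quotient is one-sided. *)
Definition Linfty_derivative A w w' : Prop :=
  forall t, A t ->
    torus_dist +oo%E (fun x => (w s x - w t x) / (s - t)) (w' t)
      @[s --> within A t^'] --> 0%E.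

Definition Linfty_C1 A w w' : Prop :=
  [/\ Linfty_continuous A w, Linfty_continuous A w' & Linfty_derivative A w w'].

Definition conv (K : 'rV[R]_N -> R) u (x : 'rV[R]_N) : R :=
  \int[lebesgue_rV R N]_x' (K (x - x') * u x').

Definition flux (K : 'rV[R]_N -> R) (D : R -> R -> R) (r b u : 'rV[R]_N -> R)
    (x : 'rV[R]_N) : R :=
  let rho x := r x + b x in
  (1 - rho x) * conv K (fun y => D (r y) (b y) * u y) x -
  D (r x) (b x) * u x * conv K (fun y => 1 - rho y) x.

Definition is_solution (K : 'rV[R]_N -> R) (Dr Db : R -> R -> R)
    (rI bI : 'rV[R]_N -> R) (T : R) (r b : R -> 'rV[R]_N -> R) : Prop :=
  [/\ Linfty_continuous `[0, T] r, Linfty_continuous `[0, T] b,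
      exists r' b', [/\ Linfty_C1 `]0, T] r r', Linfty_C1 `]0, T] b b' &
        forall t : R, 0 < t <= T ->
          r' t = flux K Dr (r t) (b t) (r t) %[ae torus_measure] /\
          b' t = flux K Db (r t) (b t) (b t) %[ae torus_measure]] &
      r 0 = rI %[ae torus_measure] /\ b 0 = bI %[ae torus_measure]].

End torus.

Definition mobility_r {R : realType} (Cr Crr Crb p q : R) : R :=
  Cr * expR (- Crr * p + Crb * q).

Definition mobility_b {R : realType} (Cb Cbr Cbb p q : R) : R :=
  Cb * expR (Cbr * p - Cbb * q).

(* Main.v *)
Require Import Defs.
From mathcomp Require Import all_boot all_order all_algebra.
From mathcomp Require Import all_classical all_reals all_analysis.
From mathcomp Require Import measurable_realfun ess_sup_inf.
From mathcomp Require Import ring lra.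

(** The system is an ordinary differential equation in [L^oo]: convolution with the
    integrable kernel [K1] is bounded on [L^oo], and the mobilities are smooth, so
    the right-hand side is Lipschitz on bounded sets ([flux_lipschitz]). What has to
    be explained is why solutions do not blow up, that is, why the simplex
    [r >= 0, b >= 0, r + b <= 1] is invariant.

    The kernel is nonnegative. Hence in the equation for [r] the loss term is [r]
    times a bounded nonnegative factor, and in the equation for [r + b] the gain term
    is [1 - (r + b)] times a bounded nonnegative factor ([flux_simplex]). An explicit
    Euler step [u + h F(u)] that is short compared with these bounds therefore maps
    the simplex to itself ([simplex_state_step]). On the simplex the velocity is
    globally bounded and Lipschitz, so Euler polygons on dyadic grids of step
    [h0 2^-n] form a Cauchy sequence, uniformly in space and on every time interval
    [[0, T]]; their limit stays in the simplex and satisfies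
    [u(t) - u(s) = (t - s) F(u(s)) + O((t - s)^2)], which makes it a [C^1] solution
    ([euler_flow], [simplex_solution]). All this takes place with functions defined
    and bounded at every point, starting from a representative of the initial data
    that lies in the simplex everywhere.

    An arbitrary solution coincides with the one just constructed
    ([solution_unique]): the sup distance of the two is continuous, vanishes
    initially and grows at most at the rate [L] times itself while it is below 1, so
    a comparison argument at a first contact time ([gronwall_first_contact]) shows
    that it is zero. Uniqueness and invariance for every solution follow at once.

    Two passages between the torus and the whole space are needed. Lebesgue measure
    is invariant under [x |-> a - x] ([lebesgue_rV_reflect]), which bounds
    convolutions and makes them periodic, and periodic properties that hold almost
    everywhere on the unit cube hold almost everywhere on [R^N] ([torus_ae_lift]).
    Finally, the [L^2] closure that defines the phase space is the set of pairs that
    lie in the simplex almost everywhere ([phaseMbar_simplex],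
    [simplex_phaseMbar]). *)

Set Implicit Arguments.
Unset Strict Implicit.
Unset Printing Implicit Defensive.
Import Order.TTheory GRing.Theory Num.Theory.
Import numFieldNormedType.Exports.
Local Open Scope classical_set_scope.
Local Open Scope ring_scope.
Local Notation conv := Defs.conv.
Local Notation periodic := Defs.periodic.

(** * Invariance of Lebesgue measure *)

Section reflection.
Context {R : realType}.

Lemma measurable_reflect n (a : 'rV[R]_n) :
  measurable_fun [set: 'rV[R]_n] (fun x => a - x).
Proof.
apply: measurable_fun_rV => i.
rewrite (_ : (fun x : 'rV[R]_n => _) = (fun x => a ord0 i - x ord0 i)); last first.
  by apply/funext => x; rewrite !mxE.
apply: measurable_funB; first exact: measurable_cst.
exact: measurable_coord.
Qed.

Lemma measurable_preimage d1 d2 (X : measurableType d1) (Y : measurableType d2)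
  (f : X -> Y) (A : set Y) :
  measurable_fun setT f -> measurable A -> measurable (f @^-1` A).
Proof. by move=> mf mA; rewrite -[X in measurable X]setTI; exact: mf. Qed.

Lemma lebesgue_measure_reflect (a : R) (A : set (measurableTypeR R)) :
  measurable A -> lebesgue_measure ((fun x => a - x) @^-1` A) = lebesgue_measure A.
Proof.
have mf : measurable_fun [set: measurableTypeR R]
    ((fun x => a - x) : measurableTypeR R -> measurableTypeR R).
  by apply: measurable_funB => //; exact: measurable_cst.
move=> mA.
apply/esym; apply: (@lebesgue_measure_unique R
  (pushforward lebesgue_measure
     ((fun x => a - x) : measurableTypeR R -> measurableTypeR R))) => //.
move=> _ [[p q]] _ <-.
have E : (fun x => a - x) @^-1` `]p, q] = `[a - q, a - p[%classic.
  apply/seteqP; split => x /=; rewrite !in_itv /= => /andP[h1 h2].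
    by rewrite lerBlDr -lerBlDl h2 /= ltrBrDl -ltrBrDr.
  by rewrite ltrBrDr -ltrBrDl h2 /= lerBlDr -lerBlDl.
transitivity (lebesgue_measure (`[(a - q), (a - p)[%classic : set R)); last by rewrite -E.
rewrite !lebesgue_measure_itv/= !lte_fin ltrD2l ltrN2.
by rewrite -!EFinB (_ : a - p - (a - q) = q - p) // opprB addrC subrKA.
Qed.

(** Reflections are treated first because a convolution integrates [K (x - y)]
    in [y], and because two reflections compose to a translation. They act
    coordinatewise, so the induction that builds the measure reduces their
    invariance to dimension one and uniqueness of product measures. *)
Lemma lebesgue_rV_reflect n (a : 'rV[R]_n) (A : set 'rV[R]_n) :
  measurable A -> lebesgue_rV R n ((fun x => a - x) @^-1` A) = lebesgue_rV R n A.
Proof.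
elim: n a A => [|n IH] a A mA.
  congr (lebesgue_rV R 0 _); apply/seteqP; split => x /=; by rewrite !thinmx0.
rewrite /= /lebesgueS /pushforward.
pose psi (p : measurableTypeR R * 'rV[R]_n) : measurableTypeR R * 'rV[R]_n :=
  ((unconsrV a).1 - p.1, (unconsrV a).2 - p.2).
have mpsi : measurable_fun setT psi.
  apply/measurable_fun_pairP; split => /=.
    by apply: measurable_funB; [exact: measurable_cst|exact: measurable_fst].
  apply: (measurableT_comp (measurable_reflect _)); exact: measurable_snd.
rewrite (_ : @consrV R n @^-1` _ = psi @^-1` (@consrV R n @^-1` A)); last first.
  apply/funext => -[x v]; congr (A _); apply/rowP => i; rewrite !mxE /=.
  by case: unliftP => [j ->|->] //=; rewrite !mxE.
have mB : measurable (@consrV R n @^-1` A) 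
  by apply: measurable_preimage => //; exact: measurable_consrV.
apply/esym; apply: (@product_measure_unique _ _ _ _ R _ _
   (pushforward (@lebesgue_measure R \x lebesgue_rV R n)%E psi)) => // X Y mX mY.
transitivity ((@lebesgue_measure R \x lebesgue_rV R n)%E
  (((fun x => (unconsrV a).1 - x) @^-1` X) `*` ((fun x => (unconsrV a).2 - x) @^-1` Y))) => //.
rewrite product_measure1E.
- by congr (_ * _)%E; [exact: lebesgue_measure_reflect | exact: IH].
- apply: measurable_preimage => //.
  by apply: measurable_funB => //; exact: measurable_cst.
- by apply: measurable_preimage => //; exact: measurable_reflect.
Qed.

Lemma measurable_translate n (a : 'rV[R]_n) :
  measurable_fun [set: 'rV[R]_n] (fun x => x + a).
Proof.
have := measurableT_comp (measurable_reflect a) (measurable_reflect (0 : 'rV[R]_n)).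
by congr measurable_fun; apply/funext => x /=; rewrite sub0r opprK addrC.
Qed.

Lemma lebesgue_rV_translate n (a : 'rV[R]_n) (A : set 'rV[R]_n) :
  measurable A -> lebesgue_rV R n ((fun x => x + a) @^-1` A) = lebesgue_rV R n A.
Proof.
move=> mA; rewrite -(lebesgue_rV_reflect a mA) -[in RHS](lebesgue_rV_reflect 0); last first.
  by apply: measurable_preimage => //; exact: measurable_reflect.
by congr (lebesgue_rV R n _); apply/seteqP; split => x /=; rewrite sub0r opprK addrC.
Qed.

Lemma measurable_rV_set1 n (a : 'rV[R]_n) : measurable [set a].
Proof.
rewrite (_ : [set a] = \bigcap_(i in [set: 'I_n]) ((fun x : 'rV[R]_n => x ord0 i)
    @^-1` [set a ord0 i])).
  apply: fin_bigcap_measurable => // i _; apply: measurable_preimage => //.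
  exact: measurable_coord.
apply/seteqP; split => [x -> i _ //|x h].
by apply/rowP => i; rewrite (h i).
Qed.

Lemma lebesgue_rV_set1 n (a : 'rV[R]_n) : (0 < n)%N -> lebesgue_rV R n [set a] = 0%E.
Proof.
case: n a => // n a _ /=; rewrite /lebesgueS /pushforward.
have m1 : measurable [set ((unconsrV a).1 : measurableTypeR R)] by exact: measurable_set1.
rewrite (_ : _ @^-1` _ = [set (unconsrV a).1] `*` [set (unconsrV a).2]).
  rewrite product_measure1E //; last exact: measurable_rV_set1.
  by rewrite [X in (X * _)%E]lebesgue_measure_set1 mul0e.
apply/seteqP; split => [[x v] /= h|[x v] [/= -> ->]].
  have e : unconsrV a = (x, v) by rewrite -h consrVK.
  by rewrite -[x]/((x, v).1) -[v]/((x, v).2) -e.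
by apply/rowP => i; rewrite mxE; case: unliftP => [j ->|->] //=; rewrite !mxE.
Qed.

End reflection.

(** * Periodicity and convolutions *)

Section torus_ae.
Context {R : realType} {N : nat}.
Local Notation leb := (lebesgue_rV R N).

(** A property that is invariant under integer translations and holds almost
    everywhere on the fundamental domain holds almost everywhere on the whole
    space: countably many translates of the unit cube cover it. *)
Lemma torus_ae_lift (P : 'rV[R]_N -> Prop) :
  (forall x (z : 'rV[int]_N), P (x + map_mx intr z) -> P x) ->
  (\forall x \ae torus_measure, P x) -> \forall x \ae leb, P x.
Proof.
move=> Pper [B [mB B0 PB]].
have mBC : measurable (B `&` unit_cube) by apply: measurableI => //; exact: measurable_unit_cube.
pose F (k : nat) : set 'rV[R]_N := if unpickle k is Some z then
   (fun x => x + map_mx intr (z : 'rV[int]_N)) @^-1` (B `&` unit_cube) else set0.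
suff : leb.-negligible (~` [set x | P x]) by [].
apply: (@negligibleS _ _ _ _ (\bigcup_k F k)); last first.
  apply: negligible_bigcup => k; rewrite /F; case: unpickle => [z|]; last exact: negligible_set0.
  exists ((fun x => x + map_mx intr z) @^-1` (B `&` unit_cube)); split => //.
    apply: measurable_preimage => //.
    exact: measurable_translate.
  exact: etrans (lebesgue_rV_translate _ mBC) B0.
move=> x nPx.
pose z : 'rV[int]_N := \row_i - Num.floor (x ord0 i).
exists (pickle z) => //; rewrite /F pickleK /=; split.
  by apply: PB => /= /Pper.
move=> i; rewrite !mxE rmorphN /=.
have /andP[h1 h2] := floor_itv (x ord0 i).
by rewrite subr_ge0 h1 /= ltrBlDl; move: h2; rewrite intrD.
Qed.

Lemma torus_measureT : torus_measure [set: 'rV[R]_N] = 1%E.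
Proof.
rewrite /torus_measure /= /mrestr setTI.
have := @lebesgue_rV_box R N (\row__ 0) (\row__ 1).
rewrite big1 => [|i _]; last by rewrite !mxE subr0.
move=> <- => [|i]; last by rewrite !mxE ler01.
by congr (leb _); apply/seteqP; split => x /= h i; have := h i; rewrite !mxE.
Qed.

Lemma ae_torus_exists (P : 'rV[R]_N -> Prop) :
  (\forall x \ae torus_measure, P x) -> exists x, P x.
Proof.
move=> aeP.
have pf : ProperFilter (almost_everywhere (torus_measure : {measure set 'rV[R]_N -> \bar R})).
  by apply: ae_properfilter_algebraOfSetsType; rewrite torus_measureT lte01.
exact: (@filter_ex _ _ pf).
Qed.

End torus_ae.


Section convolution.
Context {R : realType} {N : nat}.
Local Notation leb := (lebesgue_rV R N).
Implicit Types (K u v : 'rV[R]_N -> R) (x y : 'rV[R]_N).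

Definition kernel_mass K : R := \int[leb]_x `|K x|.

Lemma measurable_kernel_shift K (x : 'rV[R]_N) :
  measurable_fun setT K -> measurable_fun setT (fun y => K (x - y)).
Proof. move=> mK; exact: (measurableT_comp mK (measurable_reflect x)). Qed.

Lemma kernel_mass_shift K (x : 'rV[R]_N) : leb.-integrable setT (EFin \o K) ->
  (\int[leb]_y `|K (x - y)|%:E)%E = (kernel_mass K)%:E.
Proof.
move=> iK.
have mK : measurable_fun setT K by case/integrableP: iK => /measurable_EFinP.
transitivity (\int[leb]_y `|K y|%:E)%E; last first.
  rewrite /kernel_mass /Rintegral fineK //.
  exact/integrable_fin_num/integrable_norm.
pose f (y : 'rV[R]_N) : \bar R := `|K y|%:E.
have mf : measurable_fun setT f by apply/measurable_EFinP; exact: measurableT_comp.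
have := ge0_integral_pushforward (measurable_reflect x) leb measurableT mf.
rewrite preimage_setT => <- => [|y _]; last by rewrite lee_fin.
apply: eq_measure_integral; first exact: measurable_reflect.
by move=> mf' A mA _; exact: lebesgue_rV_reflect.
Qed.

Lemma kernel_mass_ge0 K : 0 <= kernel_mass K.
Proof. exact: Rintegral_ge0. Qed.

Section fixed_kernel.
Variable K : 'rV[R]_N -> R.
Hypothesis iK : leb.-integrable setT (EFin \o K).
Let mK : measurable_fun setT K.
Proof. by case/integrableP: iK => /measurable_EFinP. Qed.

Lemma measurable_conv_integrand u x : measurable_fun setT u ->
  measurable_fun setT (fun y => K (x - y) * u y).
Proof. by move=> mu; apply: measurable_funM => //; exact: measurable_kernel_shift. Qed.

(** Young's inequality for an integrable kernel and a bounded function; both the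
    integrability of the convolution integrand and the sup bound follow. *)
Lemma conv_abs_integral_le u (M : R) x : measurable_fun setT u -> 0 <= M ->
  (\forall y \ae leb, `|u y| <= M) ->
  (\int[leb]_y `|K (x - y) * u y|%:E <= (kernel_mass K * M)%:E)%E.
Proof.
move=> mu M0 uM.
apply: (@le_trans _ _ (\int[leb]_y (M%:E * `|K (x - y)|%:E))%E).
  apply: ae_ge0_le_integral => //.
  - by apply/measurable_EFinP; apply: measurableT_comp => //; exact: measurable_conv_integrand.
  - by move=> y _; rewrite mule_ge0// lee_fin.
  - apply: measurable_funeM; apply/measurable_EFinP; apply: measurableT_comp => //.
    exact: measurable_kernel_shift.
  apply: filterS uM => y uyM _; rewrite -EFinM lee_fin normrM mulrC.
  exact: ler_wpM2r.
rewrite ge0_integralZl //.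
- by rewrite kernel_mass_shift // -EFinM mulrC.
- apply/measurable_EFinP; apply: measurableT_comp => //; exact: measurable_kernel_shift.
Qed.

Lemma conv_integrable u (M : R) x : measurable_fun setT u -> 0 <= M ->
  (\forall y \ae leb, `|u y| <= M) ->
  leb.-integrable setT (EFin \o (fun y => K (x - y) * u y)).
Proof.
move=> mu M0 uM; apply/integrableP; split.
  by apply/measurable_EFinP; exact: measurable_conv_integrand.
by apply: le_lt_trans (conv_abs_integral_le x mu M0 uM) _; rewrite ltry.
Qed.

Lemma conv_bound u (M : R) x : measurable_fun setT u -> 0 <= M ->
  (\forall y \ae leb, `|u y| <= M) -> `|conv K u x| <= kernel_mass K * M.
Proof.
move=> mu M0 uM; have iKu := conv_integrable x mu M0 uM.
apply: le_trans (le_normr_Rintegral measurableT iKu) _.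
rewrite /Rintegral -lee_fin fineK; first exact: conv_abs_integral_le.
exact/integrable_fin_num/integrable_norm.
Qed.

Lemma conv_lipschitz u v (M e : R) x :
  measurable_fun setT u -> measurable_fun setT v -> 0 <= M -> 0 <= e ->
  (\forall y \ae leb, `|u y| <= M) -> (\forall y \ae leb, `|v y| <= M) ->
  (\forall y \ae leb, `|u y - v y| <= e) ->
  `|conv K u x - conv K v x| <= kernel_mass K * e.
Proof.
move=> mu mv M0 e0 uM vM uve.
rewrite /conv -RintegralB //; [|exact: conv_integrable uM|exact: conv_integrable vM].
rewrite (_ : \int[_]_y _ = conv K (u \- v) x).
  by apply: conv_bound => //; exact: measurable_funB.
by congr (Rintegral _ _ _); apply/funext => y /=; rewrite mulrBr.
Qed.

(** The kernel may be negative at the origin, where it is arbitrary, so the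
    integrand is only nonnegative away from the null set [y = x]. *)
Lemma conv_ge0 u (M : R) x : (0 < N)%N -> (forall y, y != 0 -> 0 <= K y) ->
  measurable_fun setT u -> 0 <= M ->
  (\forall y \ae leb, 0 <= u y <= M) -> 0 <= conv K u x.
Proof.
move=> N0 K0 mu M0 uM.
have uM' : \forall y \ae leb, `|u y| <= M.
  by apply: filterS uM => y /andP[u0 uM]; rewrite ger0_norm.
have xN : \forall y \ae leb, x != y.
  have m0 : measurable [set (0 : 'rV[R]_N)] by exact: measurable_rV_set1.
  exists ((fun y => x - y) @^-1` [set 0]); split.
  - by apply: measurable_preimage => //; exact: measurable_reflect.
  - exact: etrans (lebesgue_rV_reflect _ m0) (lebesgue_rV_set1 _ N0).
  by move=> y /= /negP; rewrite negbK => /eqP ->; rewrite subrr.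
rewrite /conv /Rintegral fine_ge0 //.
rewrite (ae_eq_integral (fun y => `|K (x - y) * u y|%:E)) //.
- exact: integral_ge0.
- by apply/measurable_EFinP; exact: measurable_conv_integrand.
- by apply/measurable_EFinP; apply: measurableT_comp => //; exact: measurable_conv_integrand.
- apply: filterS2 uM xN => y /andP[u0 _] xy _; rewrite ger0_norm // mulr_ge0 // K0 //.
  by rewrite subr_eq0.
Qed.

(** The integrand is not integrable on the product space, only in [y] for fixed
    [x]; Tonelli's theorem is therefore applied to its positive and negative parts
    separately. *)
Lemma measurable_conv u : measurable_fun setT u -> measurable_fun setT (conv K u).
Proof.
move=> mu.
pose f (p : 'rV[R]_N * 'rV[R]_N) : \bar R := (K (p.1 - p.2) * u p.2)%:E.
have mf : measurable_fun setT f.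
  apply/measurable_EFinP; apply: measurable_funM; last first.
    exact: (measurableT_comp mu measurable_snd).
  apply: (measurableT_comp mK); apply: measurable_fun_rV => i.
  rewrite (_ : (fun _ => _) = (fun p : 'rV[R]_N * 'rV[R]_N => p.1 ord0 i - p.2 ord0 i)).
    apply: measurable_funB.
      exact: (measurableT_comp (measurable_coord i) measurable_fst).
    exact: (measurableT_comp (measurable_coord i) measurable_snd).
  by apply/funext => p; rewrite !mxE.
rewrite (_ : conv K u = fine \o (fun x => fubini_F leb (f^\+)%E x - fubini_F leb (f^\-)%E x)%E).
  apply: measurableT_comp; first exact: fine_measurable.
  apply: emeasurable_funB; apply: measurable_fun_fubini_tonelli_F => //.
  - exact: measurable_funepos.
  - exact: measurable_funeneg.
apply/funext => x; rewrite /conv /Rintegral [in LHS]integralE /=.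
by congr (fine (_ - _)%E); apply: eq_integral => y _; rewrite ?funeposE ?funenegE.
Qed.

Lemma periodic_conv u (M : R) : measurable_fun setT u -> 0 <= M ->
  (\forall y \ae leb, `|u y| <= M) -> periodic u -> periodic (conv K u).
Proof.
move=> mu M0 uM pu x z; set w := map_mx intr z.
have mw := measurable_translate w.
rewrite /conv /Rintegral; congr fine.
pose f y := (K (x + w - y) * u y)%:E.
have fw : f \o (fun y => y + w) = (fun y => (K (x - y) * u y)%:E).
  apply/funext => y; rewrite /f /= pu; congr (K _ * _)%:E.
  by rewrite opprD addrACA subrr addr0.
have mf : measurable_fun setT f by apply/measurable_EFinP; exact: measurable_conv_integrand.
have := @integral_pushforward _ _ _ _ _ _ mw leb setT f mf.
rewrite preimage_setT fw => /(_ (conv_integrable x mu M0 uM) measurableT) <-.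
by apply: eq_measure_integral => A mA _; exact/esym/lebesgue_rV_translate.
Qed.

End fixed_kernel.
End convolution.

(** * Euler schemes with an invariant set *)

Section geometric.
Context {R : realType}.

Lemma geometric_cvg (a : nat -> R) (B l : R) :
  (forall n, `|a n - l| <= B * 2^-1 ^+ n) -> a n @[n --> \oo] --> l.
Proof.
move=> al.
have g0 : (B * 2^-1 ^+ n) @[n --> \oo] --> (0 : R).
  by apply: cvg_geometric; rewrite ger0_norm ?invr_ge0// invf_lt1 ?ltr1n.
apply: (@squeeze_cvgr _ _ _ _ (fun n => l - B * 2^-1 ^+ n)
  (fun n => l + B * 2^-1 ^+ n)).
- apply: nearW => n; have := al n; rewrite ler_norml => /andP[h1 h2].
  by apply/andP; split; lra.
- by rewrite -[X in _ --> X]subr0; apply: cvgB => //; exact: cvg_cst.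
- by rewrite -[X in _ --> X]addr0; apply: cvgD => //; exact: cvg_cst.
Qed.

(** The sequences [a n - 2 A 2^-n] and [a n + 2 A 2^-n] are monotone and enclose
    [a n], which provides the limit together with the explicit rate. *)
Lemma geometric_limit (a : nat -> R) (A : R) :
  (forall n, `|a n.+1 - a n| <= A * 2^-1 ^+ n) ->
  exists l, forall n, `|a n - l| <= (2 * A) * 2^-1 ^+ n.
Proof.
move=> aA.
pose b n := a n - 2 * A * 2^-1 ^+ n; pose c n := a n + 2 * A * 2^-1 ^+ n.
have halve n : 2^-1 ^+ n.+1 = 2^-1 * 2^-1 ^+ n :> R by rewrite exprS.
have bS : {homo b : n m / (n <= m)%N >-> n <= m}.
  apply/nondecreasing_seqP => n; rewrite /b halve.
  by have := aA n; rewrite ler_norml => /andP[h1 h2]; set y := 2^-1 ^+ n in h1 h2 *; lra.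
have cS : {homo c : n m / (n <= m)%N >-> n >= m}.
  apply/nonincreasing_seqP => n; rewrite /c halve.
  by have := aA n; rewrite ler_norml => /andP[h1 h2]; set y := 2^-1 ^+ n in h1 h2 *; lra.
have bc n m : b n <= c m.
  apply: le_trans (bS _ _ (leq_maxl n m)) _; apply: le_trans _ (cS _ _ (leq_maxr n m)).
  rewrite /b /c -subr_ge0; have := aA (maxn n m); set y := 2^-1 ^+ _ => h.
  have h0 := le_trans (normr_ge0 _) h; lra.
exists (sup (range b)) => n; rewrite ler_norml.
have h1 : b n <= sup (range b).
  apply: ub_le_sup; last by exists n.
  by exists (c 0%N) => _ [k _ <-]; exact: bc.
have h2 : sup (range b) <= c n.
  apply: ge_sup; first by exists (b 0%N), 0%N.
  by move=> _ [k _ <-]; exact: bc.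
by rewrite /b /c in h1 h2; apply/andP; split; lra.
Qed.

End geometric.

Section euler_scheme.
Context {R : realType} (S : Type).
Implicit Types (u v : S -> R).
Variables (C : set (S -> R)) (F : (S -> R) -> S -> R) (L M h0 : R).
Hypotheses (L0 : 0 <= L) (M0 : 0 <= M) (h0_gt0 : 0 < h0).
Hypothesis F_lip : forall u v (e : R), C u -> C v -> 0 <= e ->
  (forall x, `|u x - v x| <= e) -> forall x, `|F u x - F v x| <= L * e.
Hypothesis F_bound : forall u, C u -> forall x, `|F u x| <= M.
Hypothesis C_step : forall u (h : R), C u -> 0 <= h <= h0 -> C (fun x => u x + h * F u x).
Hypothesis C_closed : forall (w : nat -> S -> R) u, (forall n, C (w n)) ->
  (forall x, w n x @[n --> \oo] --> u x) -> C u.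

Definition euler (h : R) u (n : nat) : S -> R :=
  iter n (fun v x => v x + h * F v x) u.

Lemma eulerS h u n x : euler h u n.+1 x = euler h u n x + h * F (euler h u n) x.
Proof. by []. Qed.

Variable u0 : S -> R.
Hypothesis C_u0 : C u0.

Lemma euler_in h n : 0 <= h <= h0 -> C (euler h u0 n).
Proof. by move=> hh; elim: n => //= n IH; exact: C_step. Qed.

Lemma euler_drift h i j x : 0 <= h <= h0 ->
  `|euler h u0 (i + j) x - euler h u0 i x| <= j%:R * h * M.
Proof.
move=> hh; have h_ge0 : 0 <= h by case/andP: hh.
elim: j => [|j IH]; first by rewrite addn0 subrr normr0 !mul0r.
rewrite addnS eulerS addrAC -natr1 (le_trans (ler_normD _ _))//.
rewrite !mulrDl mul1r lerD// normrM ger0_norm// ler_wpM2l//.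
by apply: F_bound; exact: euler_in.
Qed.

(** Along the scheme the velocity differs from its initial value by at most
    [L] times the drift, hence the quadratic remainder; it is uniform in the step,
    so it survives in the limit. *)
Lemma euler_expansion h i j x : 0 <= h <= h0 ->
  `|euler h u0 (i + j) x - euler h u0 i x - j%:R * h * F (euler h u0 i) x|
    <= L * M * (j%:R * h) ^+ 2.
Proof.
move=> hh; have h_ge0 : 0 <= h by case/andP: hh.
elim: j => [|j IH]; first by rewrite addn0 subrr !mul0r subr0 normr0 expr0n mulr0.
have jhM : 0 <= j%:R * h * M by rewrite !mulr_ge0.
have := F_lip (euler_in (i + j) hh) (euler_in i hh) jhM (euler_drift i j ^~ hh) x.
move=> dF; rewrite addnS eulerS -natr1.
set a := euler h u0 (i + j) x in IH *; set b := euler h u0 i x in IH *.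
set Fa := F _ x in dF *; set Fb := F (euler h u0 i) x in dF IH *.
rewrite (_ : _ - _ = (a - b - j%:R * h * Fb) + h * (Fa - Fb)); last by ring.
apply: le_trans (ler_normD _ _) _.
have k : `|h * (Fa - Fb)| <= h * (L * (j%:R * h * M)).
  by rewrite normrM ger0_norm// ler_wpM2l.
apply: le_trans (lerD IH k) _.
have e : 0 <= L * M * (j%:R * h * h + h * h).
  by rewrite mulr_ge0 ?mulr_ge0 // addr_ge0 ?mulr_ge0.
by rewrite -subr_ge0; apply: le_trans e _; rewrite le_eqVlt; apply/orP; left; apply/eqP; ring.
Qed.

(** Two half steps differ from one step by [h^2 L M / 4], and earlier errors are
    amplified by [1 + h L] at each step; the right-hand side is the supersolution
    of this recursion that vanishes for [k = 0]. *)
Lemma euler_halve h k x : 0 <= h <= h0 ->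
  `|euler (2^-1 * h) u0 k.*2 x - euler h u0 k x| <= h * M * (1 + h * L) ^+ k - h * M.
Proof.
move=> hh; have h_ge0 : 0 <= h by case/andP: hh.
have hh2 : 0 <= 2^-1 * h <= h0 by case/andP: hh => ? ?; apply/andP; split; lra.
elim: k x => [|k IH] x; first by rewrite subrr normr0 expr0 mulr1 subrr.
set e := (X in _ <= X) in IH *.
have e0 : 0 <= h * M * (1 + h * L) ^+ k - h * M.
  exact: le_trans (normr_ge0 _) (IH x).
have dF := F_lip (euler_in k.*2 hh2) (euler_in k hh) e0 IH x.
have hM : 0 <= 1%:R * (2^-1 * h) * M by rewrite !mulr_ge0// invr_ge0.
have := F_lip (euler_in (k.*2 + 1) hh2) (euler_in k.*2 hh2) hM (euler_drift _ _ ^~ hh2) x.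
have := IH x; rewrite /e {e} => ab dF1.
have -> : euler (2^-1 * h) u0 k.+1.*2 x = euler (2^-1 * h) u0 k.*2 x +
    2^-1 * h * F (euler (2^-1 * h) u0 k.*2) x +
    2^-1 * h * F (euler (2^-1 * h) u0 (k.*2 + 1)) x by rewrite doubleS !eulerS addn1.
rewrite eulerS exprS.
set p := _ ^+ k in ab dF e0 *.
set F1 := F (euler _ _ (_ + _)) x in dF1 *.
set F0 := F (euler _ _ k.*2) x in dF dF1 *; set G := F _ x in dF *.
set a := euler _ _ k.*2 x in ab *; set b := euler _ _ _ x in ab *.
rewrite (_ : _ - _ = (a - b) + h * (F0 - G) + 2^-1 * h * (F1 - F0)); last first.
  by field.
apply: le_trans (ler_normD _ _) _; apply: le_trans (lerD (ler_normD _ _) (lexx _)) _.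
rewrite !normrM [`|h|]ger0_norm// [`|2^-1|]ger0_norm ?invr_ge0//.
have k1 := ler_wpM2l h_ge0 dF.
have h2 : 0 <= 2^-1 * h by rewrite mulr_ge0 // invr_ge0.
have k2 := ler_wpM2l h2 dF1.
have k3 : 0 <= h * h * (L * M) by rewrite !mulr_ge0.
nra.
Qed.

Let q n : R := h0 * 2^-1 ^+ n.

Let q_gt0 n : 0 < q n. Proof. by rewrite mulr_gt0 // exprn_gt0 // invr_gt0. Qed.

Let q_itv n : 0 <= q n <= h0.
Proof.
rewrite ltW //= ger_pMr // exprn_ile1 // ?invr_ge0 // invf_le1 // ler1n //.
Qed.

Let qS n : q n.+1 = 2^-1 * q n. Proof. by rewrite /q exprS mulrCA. Qed.

Definition grid_index n (t : R) := Num.trunc (t / q n).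

Lemma grid_index_itv n t : 0 <= t ->
  (grid_index n t)%:R * q n <= t < (grid_index n t)%:R * q n + q n.
Proof.
move=> t0; have /truncn_itv : 0 <= t / q n by rewrite divr_ge0 // ltW.
rewrite -/(grid_index n t) ler_pdivlMr // ltr_pdivrMr // => /andP[-> h] /=.
by rewrite -natr1 mulrDl mul1r in h.
Qed.

Lemma grid_indexS n t : 0 <= t ->
  exists2 j, (j <= 1)%N & grid_index n.+1 t = ((grid_index n t).*2 + j)%N.
Proof.
move=> t0; have /andP[a1 a2] := grid_index_itv n t0.
have /andP[] := grid_index_itv n.+1 t0; rewrite qS => b1 b2.
have qn := q_gt0 n.
set k := grid_index n t in a1 a2 *; set m := grid_index n.+1 t in b1 b2 *.
have h1 : (k.*2 <= m)%N.
  rewrite -ltnS -(ltr_nat R) -muln2 natrM -natr1 -(ltr_pM2r qn); nra.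
have h2 : (m <= k.*2.+1)%N.
  rewrite -ltnS -(ltr_nat R) -muln2 -!natr1 natrM -(ltr_pM2r qn); nra.
by exists (m - k.*2)%N; [rewrite leq_subLR addn1|rewrite subnKC].
Qed.

(** Piecewise constant interpolation on the grid of step [h0 2^-n]: constant rather
    than affine, because only grid values are then compared. *)
Definition euler_path n (t : R) : S -> R := euler (q n) u0 (grid_index n t).

Variable T : R.

Let A := h0 * M * (expR (L * T) + 1).

Lemma euler_path_step n t x : 0 <= t <= T ->
  `|euler_path n.+1 t x - euler_path n t x| <= A * 2^-1 ^+ n.
Proof.
move=> /andP[t0 tT]; rewrite /euler_path.
have [j j1 ->] := grid_indexS n t0.
have /andP[kt _] := grid_index_itv n t0.
set k := grid_index n t in kt *.
have d := euler_drift k.*2 j x (q_itv n.+1).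
have hv := euler_halve k x (q_itv n); rewrite -qS in hv.
have pe : (1 + q n * L) ^+ k <= expR (L * T).
  apply: (@le_trans _ _ (expR (q n * L) ^+ k)).
    rewrite lerXn2r ?nnegrE ?expR_ge0 ?expR_ge1Dx //.
    by rewrite addr_ge0 // mulr_ge0 // ltW.
  rewrite -expRM_natl ler_expR (_ : k%:R * (q n * L) = L * (k%:R * q n)); last by ring.
  by rewrite ler_wpM2l // (le_trans kt).
have qM : 0 <= q n * M by rewrite mulr_ge0 // ltW.
have j1' : j%:R <= 1 :> R by rewrite (ler_nat R j 1).
have dj : j%:R * q n.+1 * M <= q n * M.
  apply: (@le_trans _ _ (1 * (q n.+1 * M))).
    by rewrite -mulrA ler_wpM2r // mulr_ge0 // ltW.
  by rewrite qS mul1r -mulrA; lra.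
rewrite (_ : _ - _ = (euler (q n.+1) u0 (k.*2 + j) x - euler (q n.+1) u0 k.*2 x) +
  (euler (q n.+1) u0 k.*2 x - euler (q n) u0 k x)); last by rewrite subrKA.
apply: le_trans (ler_normD _ _) _; apply: le_trans (lerD d hv) _.
have := ler_wpM2l qM pe; rewrite (_ : A * _ = q n * M * expR (L * T) + q n * M).
  by lra.
by rewrite /A /q; ring.
Qed.

(** Existence for a Lipschitz vector field on a set of functions, all estimates
    being uniform in the space variable. The scheme never leaves [C], so neither
    does its limit: invariance comes with the construction instead of being proved
    afterwards. The expansion replaces a time integral, and differentiability in
    time is read off from it. *)
Lemma euler_flow : exists u : R -> S -> R,
  [/\ u 0 = u0, forall t, 0 <= t <= T -> C (u t) &
      forall s t x, 0 <= s -> s <= t -> t <= T ->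
        `|u t x - u s x - (t - s) * F (u s) x| <= L * M * (t - s) ^+ 2].
Proof.
pose u t x := limn (fun n => euler_path n t x).
have uA t x : 0 <= t <= T -> forall n, `|euler_path n t x - u t x| <= 2 * A * 2^-1 ^+ n.
  move=> tT; have [l al] := geometric_limit (fun n => euler_path_step n x tT).
  suff -> : u t x = l by [].
  exact/cvg_lim/(geometric_cvg al).
have A0 : 0 <= A by rewrite /A !mulr_ge0 ?addr_ge0 ?expR_ge0 // ltW.
have inC n t : C (euler_path n t) by exact: euler_in (q_itv n).
have uC t : 0 <= t <= T -> C (u t).
  move=> tT; apply: (C_closed (inC ^~ t)) => x.
  exact: geometric_cvg (uA t x tT).
exists u; split => //.
  apply/funext => x; rewrite /u (_ : (fun n => _) = cst (u0 x)) ?lim_cst //.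
  by apply/funext => n; rewrite /euler_path /grid_index mul0r truncn0.
move=> s t x s0 st tT.
have t0 := le_trans s0 st; have sT := le_trans st tT.
have tI : 0 <= t <= T by rewrite t0.
have sI : 0 <= s <= T by rewrite s0.
pose k n := (grid_index n t - grid_index n s)%N.
have kE n : (k n)%:R = (grid_index n t)%:R - (grid_index n s)%:R :> R.
  by rewrite natrB // le_truncn // ler_pM2r // invr_gt0.
have gcvg r : 0 <= r -> (grid_index n r)%:R * q n @[n --> \oo] --> r.
  move=> r0; apply: (@geometric_cvg _ _ h0) => n; rewrite -/(q n).
  have /andP[h1 h2] := grid_index_itv n r0.
  by rewrite distrC ger0_norm ?subr_ge0 //; lra.
have kcvg : (k n)%:R * q n @[n --> \oo] --> t - s.
  under eq_fun do rewrite kE mulrBl.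
  by apply: cvgB; exact: gcvg.
have ucvg r : 0 <= r <= T -> euler_path n r x @[n --> \oo] --> u r x.
  by move=> rT; exact: geometric_cvg (uA r x rT).
have Fcvg : F (euler_path n s) x @[n --> \oo] --> F (u s) x.
  apply: (@geometric_cvg _ _ (L * (2 * A))) => n; rewrite -mulrA.
  apply: F_lip => //; first exact: uC.
  - exact: le_trans (normr_ge0 _) (uA s x sI n).
  - by move=> y; exact: uA.
have lhs : `|euler_path n t x - euler_path n s x - (k n)%:R * q n * F (euler_path n s) x|
    @[n --> \oo] --> `|u t x - u s x - (t - s) * F (u s) x|.
  apply: cvg_norm; apply: cvgB; first by apply: cvgB; exact: ucvg.
  exact: cvgM.
have rhs : L * M * ((k n)%:R * q n) ^+ 2 @[n --> \oo] --> L * M * (t - s) ^+ 2.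
  apply: cvgM; first exact: cvg_cst.
  by rewrite expr2; under eq_fun do rewrite expr2; exact: cvgM.
apply: ler_cvg_to lhs rhs _; apply: nearW => n; rewrite /euler_path.
have -> : grid_index n t = (grid_index n s + k n)%N.
  by rewrite subnKC // le_truncn // ler_pM2r // invr_gt0.
exact: euler_expansion.
Qed.

End euler_scheme.

(** * Estimates for the mobilities and the flux *)

Section mobility.
Context {R : realType}.

Lemma ler_norm_mulB (a a' b b' A B da db : R) :
  `|a| <= A -> `|b'| <= B -> `|a - a'| <= da -> `|b - b'| <= db ->
  `|a * b - a' * b'| <= A * db + B * da.
Proof.
move=> aA bB ada bdb.
rewrite (_ : _ - _ = a * (b - b') + (a - a') * b'); last by ring.
apply: le_trans (ler_normD _ _) _; rewrite !normrM lerD //.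
  by rewrite ler_pM.
by rewrite mulrC ler_pM.
Qed.

Lemma expR_lipschitz (c x y : R) : x <= c -> y <= c ->
  `|expR x - expR y| <= expR c * `|x - y|.
Proof.
wlog xy : x y / y <= x => [H xc yc|xc yc].
  have [|/ltW] := leP y x; first by move=> h; exact: H.
  by move=> h; rewrite distrC [`|x - y|]distrC; exact: H.
rewrite !ger0_norm ?subr_ge0 ?ler_expR //.
have h := expR_ge1Dx (y - x).
have ey : expR y = expR x * expR (y - x) by rewrite -expRD addrC subrK.
apply: (@le_trans _ _ (expR x * (x - y))).
  have := ler_wpM2l (expR_ge0 x) h; rewrite -ey; lra.
by rewrite ler_wpM2r ?subr_ge0 // ler_expR.
Qed.

(** The box of radius 2 is a neighbourhood of the simplex, which leaves room for
    comparing a solution in the simplex with one that is not yet known to stay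
    there. *)
Definition tame_mobility (m l : R) (D : R -> R -> R) : Prop :=
  [/\ measurable_fun setT (fun p : R * R => D p.1 p.2),
      forall p q, `|p| <= 2 -> `|q| <= 2 -> 0 <= D p q <= m &
      forall p q p' q' e, `|p| <= 2 -> `|q| <= 2 -> `|p'| <= 2 -> `|q'| <= 2 ->
        `|p - p'| <= e -> `|q - q'| <= e -> `|D p q - D p' q'| <= l * e].

Lemma tame_exponential (c alpha beta : R) : 0 < c ->
  exists m l, [/\ 0 <= m, 0 <= l &
    tame_mobility m l (fun p q => c * expR (alpha * p + beta * q))].
Proof.
move=> c0; pose s := `|alpha| + `|beta|; pose m := c * expR (s * 2).
have s0 : 0 <= s by rewrite addr_ge0.
have m0 : 0 <= m by rewrite mulr_ge0 ?expR_ge0 // ltW.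
have lin p q e : `|p| <= e -> `|q| <= e -> `|alpha * p + beta * q| <= s * e.
  move=> pe qe; apply: le_trans (ler_normD _ _) _; rewrite !normrM mulrDl lerD //.
    by rewrite ler_wpM2l.
  by rewrite ler_wpM2l.
exists m, (m * s); split => //; first by rewrite mulr_ge0.
split => /=.
- apply: measurable_funM => //; apply: measurableT_comp => //.
  by apply: measurable_funD; apply: measurable_funM => //.
- move=> p q p2 q2; rewrite mulr_ge0 ?expR_ge0 ?(ltW c0) //= ler_pM2l // ler_expR.
  exact: le_trans (ler_norm _) (lin _ _ _ p2 q2).
- move=> p q p' q' e p2 q2 p'2 q'2 pe qe.
  rewrite -mulrBr normrM (gtr0_norm c0) /m -!mulrA ler_pM2l //.
  have b1 := le_trans (ler_norm _) (lin _ _ _ p2 q2).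
  have b2 := le_trans (ler_norm _) (lin _ _ _ p'2 q'2).
  apply: le_trans (expR_lipschitz b1 b2) _; rewrite ler_wpM2l ?expR_ge0 //.
  rewrite (_ : _ - _ = alpha * (p - p') + beta * (q - q')); last by ring.
  exact: lin.
Qed.

Lemma tame_weaken (m l m' l' : R) D : m <= m' -> l <= l' ->
  tame_mobility m l D -> tame_mobility m' l' D.
Proof.
move=> mm ll [mD D0 Dl]; split => //.
  by move=> p q p2 q2; have /andP[-> h] := D0 p q p2 q2; rewrite (le_trans h).
move=> p q p' q' e p2 q2 p'2 q'2 pe qe; apply: le_trans (Dl _ _ _ _ _ p2 q2 p'2 q'2 pe qe) _.
by rewrite ler_wpM2r // (le_trans _ pe).
Qed.

End mobility.

Section flux_estimates.
Context {R : realType} {N : nat}.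
Local Notation leb := (lebesgue_rV R N).
Variable K : 'rV[R]_N -> R.
Hypothesis iK : leb.-integrable setT (EFin \o K).
Local Notation kappa := (kernel_mass K).
Variables (m l : R) (D : R -> R -> R).
Hypotheses (m0 : 0 <= m) (l0 : 0 <= l) (tD : tame_mobility m l D).
Implicit Types (r b w : 'rV[R]_N -> R) (x y : 'rV[R]_N).

(** The third function [w] is the transported species, equal to [r] or to [b]; it is
    kept separate so that both equations are covered at once. *)
Definition box2 r b w x : Prop := [/\ `|r x| <= 2, `|b x| <= 2 & `|w x| <= 2].

Definition close3 (e : R) r b w r' b' w' x : Prop :=
  [/\ `|r x - r' x| <= e, `|b x - b' x| <= e & `|w x - w' x| <= e].

Lemma measurable_mobility r b w : measurable_fun setT r -> measurable_fun setT b ->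
  measurable_fun setT w -> measurable_fun setT (fun y => D (r y) (b y) * w y).
Proof.
move=> mr mb mw; apply: measurable_funM => //.
case: tD => mD _ _.
exact: (measurableT_comp mD (measurable_fun_pair mr mb)).
Qed.

Lemma measurable_void r b : measurable_fun setT r -> measurable_fun setT b ->
  measurable_fun setT (fun y => 1 - (r y + b y)).
Proof. by move=> mr mb; apply: measurable_funB => //; exact: measurable_funD. Qed.

Lemma box2_mobility r b w x : box2 r b w x -> `|D (r x) (b x) * w x| <= 2 * m.
Proof.
case=> r2 b2 w2; case: tD => _ D0 _; have /andP[d0 dm] := D0 _ _ r2 b2.
by rewrite normrM (ger0_norm d0) mulrC ler_pM.
Qed.

Lemma box2_void r b w x : box2 r b w x -> `|1 - (r x + b x)| <= 5.
Proof.
case; rewrite !ler_norml => /andP[? ?] /andP[? ?] _.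
by apply/andP; split; lra.
Qed.

Lemma close3_mobility e r b w r' b' w' x :
  box2 r b w x -> box2 r' b' w' x -> close3 e r b w r' b' w' x ->
  `|D (r x) (b x) * w x - D (r' x) (b' x) * w' x| <= (m + 2 * l) * e.
Proof.
case=> r2 b2 w2 [r2' b2' w2'] [re be we]; case: tD => _ D0 Dl.
have /andP[d0 dm] := D0 _ _ r2 b2.
have := @ler_norm_mulB _ (D (r x) (b x)) (D (r' x) (b' x)) (w x) (w' x) m 2 (l * e) e.
rewrite (ger0_norm d0) => /(_ dm w2' (Dl _ _ _ _ _ r2 b2 r2' b2' re be) we).
by rewrite [in X in _ -> X](_ : (m + 2 * l) * e = m * e + 2 * (l * e)) //; ring.
Qed.

Lemma close3_void e r b w r' b' w' x : close3 e r b w r' b' w' x ->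
  `|1 - (r x + b x) - (1 - (r' x + b' x))| <= 2 * e.
Proof.
case; rewrite !ler_norml => /andP[? ?] /andP[? ?] _.
by apply/andP; split; lra.
Qed.

(** The flux is a difference of two products of bounded Lipschitz factors. On the
    box the convolved mobility and void are at most [2 m kappa] and [5 kappa], and
    the product rule adds up to [kappa (18 m + 20 l)]. Away from the point [x] the
    hypotheses are almost everywhere ones, so that the estimate serves both for
    functions controlled at every point and for classes of functions. *)
Lemma flux_lipschitz e r b w r' b' w' x : 0 <= e ->
  measurable_fun setT r -> measurable_fun setT b -> measurable_fun setT w ->
  measurable_fun setT r' -> measurable_fun setT b' -> measurable_fun setT w' ->
  (\forall y \ae leb, box2 r b w y) -> (\forall y \ae leb, box2 r' b' w' y) ->
  (\forall y \ae leb, close3 e r b w r' b' w' y) ->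
  box2 r b w x -> box2 r' b' w' x -> close3 e r b w r' b' w' x ->
  `|flux K D r b w x - flux K D r' b' w' x| <= kappa * (18 * m + 20 * l) * e.
Proof.
move=> e0 mr mb mw mr' mb' mw' B B' Cl Bx Bx' Clx.
pose g r b w y := D (r y) (b y) * w y.
pose v r b y : R := 1 - (r y + b y).
have mg := measurable_mobility mr mb mw.
have mg' := measurable_mobility mr' mb' mw'.
have mv := measurable_void mr mb.
have mv' := measurable_void mr' mb'.
have m2 : 0 <= 2 * m by rewrite mulr_ge0.
have ml : 0 <= (m + 2 * l) * e by rewrite mulr_ge0 // addr_ge0 // mulr_ge0.
have Bg' : \forall y \ae leb, `|g r' b' w' y| <= 2 * m.
  by apply: filterS B' => y; exact: box2_mobility.
have Bv' : \forall y \ae leb, `|v r' b' y| <= 5.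
  by apply: filterS B' => y; exact: box2_void.
have dA : `|conv K (g r b w) x - conv K (g r' b' w') x| <= kappa * ((m + 2 * l) * e).
  apply: (conv_lipschitz iK x mg mg' m2 ml) => //.
    by apply: filterS B => y; exact: box2_mobility.
  apply: filterS3 B B' Cl => y; exact: close3_mobility.
have dB : `|conv K (v r b) x - conv K (v r' b') x| <= kappa * (2 * e).
  apply: (@conv_lipschitz _ _ _ iK _ _ 5 _ x mv mv') => //; first by rewrite mulr_ge0.
    by apply: filterS B => y; exact: box2_void.
  by apply: filterS Cl => y; exact: close3_void.
have bA := conv_bound iK x mg' m2 Bg'.
have bB := conv_bound iK x mv' (ler0n _ 5) Bv'.
have := ler_norm_mulB (box2_void Bx) bA (close3_void Clx) dA.
have := ler_norm_mulB (box2_mobility Bx) bB (close3_mobility Bx Bx' Clx) dB.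
rewrite /flux -/(g r b w) -/(g r' b' w') -/(v r b) -/(v r' b').
set p1 := _ * conv K (v r b) x; set p2 := _ * conv K (v r' b') x => h1.
set p3 := _ * conv K (g r b w) x; set p4 := _ * conv K (g r' b' w') x => h2.
rewrite (_ : p3 - p1 - (p4 - p2) = (p3 - p4) - (p1 - p2)); last by ring.
apply: le_trans (ler_normB _ _) _; apply: le_trans (lerD h2 h1) _.
rewrite le_eqVlt; apply/orP; left; apply/eqP; ring.
Qed.

Lemma measurable_flux r b w : measurable_fun setT r -> measurable_fun setT b ->
  measurable_fun setT w -> measurable_fun setT (flux K D r b w).
Proof.
move=> mr mb mw.
have mg := measurable_mobility mr mb mw; have mv := measurable_void mr mb.
by apply: measurable_funB; apply: measurable_funM => //; exact: measurable_conv.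
Qed.

Lemma periodic_flux r b w : measurable_fun setT r -> measurable_fun setT b ->
  measurable_fun setT w -> (\forall y \ae leb, box2 r b w y) ->
  periodic r -> periodic b -> periodic w -> periodic (flux K D r b w).
Proof.
move=> mr mb mw B pr pb pw x z; rewrite /flux pr pb pw.
have m2 : 0 <= 2 * m by rewrite mulr_ge0.
congr (_ * _ - _ * _).
  apply: (periodic_conv iK (measurable_mobility mr mb mw) m2).
    by apply: filterS B => y; exact: box2_mobility.
  by move=> y z'; rewrite pr pb pw.
apply: (periodic_conv iK (measurable_void mr mb) (ler0n _ 5)).
  by apply: filterS B => y; exact: box2_void.
by move=> y z'; rewrite pr pb.
Qed.

(** The gain-loss structure of the flux: gain is proportional to the void [1 - rho]
    and loss is proportional to the species [w] itself. *)
Lemma flux_simplex r b w x : (0 < N)%N -> (forall y, y != 0 -> 0 <= K y) ->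
  measurable_fun setT r -> measurable_fun setT b -> measurable_fun setT w ->
  (forall y, [/\ 0 <= r y, 0 <= b y & r y + b y <= 1]) -> (forall y, 0 <= w y <= 1) ->
  exists A B d, [/\ flux K D r b w x = (1 - (r x + b x)) * A - d * w x * B,
    0 <= A <= kappa * m, 0 <= B <= kappa & 0 <= d <= m].
Proof.
move=> N0 K0 mr mb mw rb w01; case: (tD) => _ D0 _.
have Dm y : 0 <= D (r y) (b y) <= m.
  by have [? ? ?] := rb y; apply: D0; rewrite ger0_norm //; lra.
exists (conv K (fun y => D (r y) (b y) * w y) x),
  (conv K (fun y => 1 - (r y + b y)) x), (D (r x) (b x)).
have mg := measurable_mobility mr mb mw; have mv := measurable_void mr mb.
have g01 y : 0 <= D (r y) (b y) * w y <= m.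
  have /andP[d0 dm] := Dm y; have /andP[w0 w1] := w01 y.
  by rewrite mulr_ge0 //= -[leRHS]mulr1 ler_pM.
have v01 y : 0 <= 1 - (r y + b y) <= 1.
  by have [? ? ?] := rb y; apply/andP; split; lra.
have gn y : `|D (r y) (b y) * w y| <= m by have /andP[g0 g1] := g01 y; rewrite ger0_norm.
have vn y : `|1 - (r y + b y)| <= 1 by have /andP[g0 g1] := v01 y; rewrite ger0_norm.
split => //; apply/andP; split.
- by apply: (conv_ge0 iK x N0 K0 mg m0); exact: aeW.
- by apply: le_trans (ler_norm _) _; apply: (conv_bound iK x mg m0); exact: aeW.
- by apply: (conv_ge0 iK x N0 K0 mv ler01); exact: aeW.
- rewrite -[leRHS]mulr1.
  by apply: le_trans (ler_norm _) _; apply: (conv_bound iK x mv ler01); exact: aeW.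
Qed.

End flux_estimates.

(** * Distances on the torus and the closed phase space *)

Section Linfty.
Context {R : realType} {N : nat}.
Implicit Types (u v w : 'rV[R]_N -> R).
Local Notation mu := (@torus_measure R N).

Lemma torus_measureT_gt0 : (0 < mu [set: 'rV[R]_N])%E.
Proof. by rewrite torus_measureT lte01. Qed.

Lemma torus_dist_leP u v (e : R) :
  (torus_dist +oo u v <= e%:E)%E <-> (\forall x \ae mu, `|u x - v x| <= e).
Proof.
rewrite /torus_dist unlock torus_measureT_gt0; split.
  by move=> /ess_supP; apply: filterS => x /=; rewrite lee_fin.
by move=> h; apply/ess_supP; apply: filterS h => x /=; rewrite lee_fin.
Qed.

Lemma torus_dist_ge0 p u v : (0 <= torus_dist p u v)%E.
Proof. exact: Lnorm_ge0. Qed.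

Lemma torusLy_intro u (M : R) : periodic u -> measurable_fun setT u ->
  (\forall x \ae mu, `|u x| <= M) -> torusL +oo u.
Proof.
move=> pu mu_ uM; split => //; rewrite inE; apply/andP; split; rewrite inE //=.
rewrite /finite_norm unlock torus_measureT_gt0; apply: (@le_lt_trans _ _ M%:E); last exact: ltry.
by apply/ess_supP; apply: filterS uM => x /=; rewrite lee_fin.
Qed.

Lemma torusLy_measurable u : torusL +oo u -> measurable_fun setT u.
Proof. by case=> _; rewrite inE => /andP[]; rewrite inE. Qed.

Lemma torusLy_bounded u : torusL +oo u -> exists M, \forall x \ae mu, `|u x| <= M.
Proof.
case=> _; rewrite inE => /andP[_]; rewrite inE /= /finite_norm unlock torus_measureT_gt0.
by move=> /ess_supr_bounded.
Qed.

Lemma torusLy_L2 u : torusL +oo u -> torusL 2%:E u.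
Proof.
case=> pu Lu; split => //; apply: Lfun_subset Lu => //.
- by rewrite lee_fin ler1n.
- by rewrite leey.
- by rewrite torus_measureT.
- by rewrite leey.
Qed.

Lemma torus_L2_measurable u : torusL 2%:E u -> measurable_fun setT u.
Proof. by case=> _; rewrite inE => /andP[]; rewrite inE. Qed.

Lemma torus_dist2_sqr u v :
  (torus_dist 2%:E u v `^ 2 = \int[mu]_x ((u x - v x) ^+ 2)%:E)%E.
Proof.
rewrite /torus_dist poweR_Lnorm ?pnatr_eq0 //; apply: eq_integral => x _ /=.
by rewrite powR_mulrn // real_normK // num_real.
Qed.

Lemma measurable_sqrB u v : measurable_fun setT u -> measurable_fun setT v ->
  measurable_fun setT (fun x => ((u x - v x) ^+ 2)%:E).
Proof.
move=> mu_ mv; apply/measurable_EFinP; apply: measurable_funX.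
exact: measurable_funB.
Qed.

(** The torus has mass 1, so the [L^2] distance is at most the sup distance. *)
Lemma torus_dist2_le u v (e : R) : 0 <= e -> measurable_fun setT u ->
  measurable_fun setT v -> (\forall x \ae mu, `|u x - v x| <= e) ->
  (torus_dist 2%:E u v <= e%:E)%E.
Proof.
move=> e0 mu_ mv uve.
have d0 := torus_dist_ge0 2%:E u v.
have sq : (torus_dist 2%:E u v `^ 2 <= (e ^+ 2)%:E)%E.
  rewrite torus_dist2_sqr.
  have -> : (e ^+ 2)%:E = (\int[mu]_x (e ^+ 2)%:E)%E.
    by rewrite integral_cst // torus_measureT mule1.
  apply: ae_ge0_le_integral => //.
  - by move=> x _; rewrite lee_fin sqr_ge0.
  - exact: measurable_sqrB.
  - by move=> x _; rewrite lee_fin sqr_ge0.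
  - apply: filterS uve => x h _; rewrite lee_fin -real_normK ?num_real //.
    by rewrite lerXn2r // nnegrE.
have root (z : \bar R) : (0 <= z)%E -> z = ((z `^ 2) `^ 2^-1)%E.
  by move=> z0; rewrite -poweRrM mulfV ?pnatr_eq0 // poweRe1.
rewrite (root _ d0) [leRHS]root ?lee_fin // poweR_EFin powR_mulrn //.
apply: gt0_ler_poweR => //; rewrite ?invr_ge0 // in_itv /= ?poweR_ge0 ?leey //.
by rewrite lee_fin sqr_ge0.
Qed.

Lemma torus_dist2_chebyshev u v (e a : R) : 0 < a -> measurable_fun setT u ->
  measurable_fun setT v -> (torus_dist 2%:E u v < e%:E)%E ->
  (mu [set x | (a <= `|u x - v x|)%R] <= ((e / a) ^+ 2)%:E)%E.
Proof.
move=> a0 mu_ mv d.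
have d0 := torus_dist_ge0 2%:E u v.
have e0 : 0 <= e by rewrite -lee_fin (le_trans d0) // ltW.
have sq : (\int[mu]_x ((u x - v x) ^+ 2)%:E <= (e ^+ 2)%:E)%E.
  rewrite -torus_dist2_sqr -powR_mulrn //.
  have e1 : (e%:E `^ 2 = (e `^ 2)%:E)%E by [].
  rewrite -e1; apply: gt0_ler_poweR => //; last exact: ltW.
    by rewrite in_itv /= d0 leey.
  by rewrite in_itv /= lee_fin e0 leey.
have a2 : 0 < a ^+ 2 by rewrite exprn_gt0.
have E : [set x : 'rV[R]_N | ((a ^+ 2)%:E <= `|((u x - v x) ^+ 2)%:E|)%E] =
    [set x | (a <= `|u x - v x|)%R].
  apply/seteqP; split => x /=;
  by rewrite lee_fin (ger0_norm (sqr_ge0 _)) -(real_normK (num_real (u x - v x)))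
    ler_pXn2r ?nnegrE // ltW.
have := @le_integral_abse _ _ R mu setT measurableT _ (a ^+ 2) (measurable_sqrB mu_ mv) a2.
rewrite setTI E.
under eq_integral do rewrite gee0_abs ?lee_fin ?sqr_ge0 //.
move=> /le_trans /(_ sq); rewrite expr_div_n EFinM -lee_pdivlMl //.
by rewrite muleC.
Qed.

(** Where [u <= - a] and [v >= 0], the two functions are [a]-apart, so such a set has
    arbitrarily small measure. *)
Lemma ae_ge0_close_in_measure u : measurable_fun setT u ->
  (forall a e : R, 0 < a -> 0 < e -> exists2 v, (\forall x \ae mu, 0 <= v x) &
    exists2 B, measurable B & [set x | (a <= `|u x - v x|)%R] `<=` B /\ (mu B <= e%:E)%E) ->
  \forall x \ae mu, 0 <= u x.
Proof.
move=> mu_ H.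
suff: forall n : nat, \forall x \ae mu, - n.+1%:R^-1 < u x.
  move=> /ae_foralln; apply: filterS => x h; rewrite leNgt; apply/negP => u0.
  have [n hn] : exists n, n.+1%:R^-1 < - u x.
    have u0' : 0 < - u x by rewrite oppr_gt0.
    have [n _ hn] := near_infty_natSinv_lt (PosNum u0').
    by exists n; exact: (hn n (leqnn n)).
  by move: (h n); rewrite ltrNl => /(lt_trans hn); rewrite ltxx.
move=> n; set a : R := n.+1%:R^-1.
have a0 : 0 < a by rewrite invr_gt0.
have mA : measurable [set x | u x <= - a].
  rewrite (_ : mkset _ = u @^-1` `]-oo, (- a)]); first exact: measurable_preimage.
  by apply/seteqP; split => x /=; rewrite in_itv.
exists [set x | u x <= - a]; split => //; last by move=> x /= /negP; rewrite -leNgt.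
apply/eqP; rewrite eq_le measure_ge0 andbT; apply/lee_addgt0Pr => e e0; rewrite add0e.
have [v [V [mV V0 vV]] [B mB [uB Be]]] := H a e a0 e0.
apply: (@le_trans _ _ (mu (V `|` B))).
  apply: le_measure; rewrite ?inE //; first exact: measurableU.
  move=> x /= ua; have [v0|v0] := lerP 0 (v x); [right; apply: uB|left; apply: vV] => /=.
    by rewrite ler0_norm; lra.
  by apply/negP; rewrite -ltNge.
apply: (le_trans (measureU2 _ mV mB)).
by rewrite [X in (X + _)%E](_ : _ = 0%E) ?add0e.
Qed.

Definition ae_simplex (r b : 'rV[R]_N -> R) : Prop :=
  \forall x \ae mu, [/\ 0 <= r x, 0 <= b x & r x + b x <= 1].

Lemma measurable_close_set u v (a : R) : measurable_fun setT u -> measurable_fun setT v ->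
  measurable [set x | (a <= `|u x - v x|)%R].
Proof.
move=> mu_ mv.
rewrite (_ : mkset _ = (fun x => `|u x - v x|) @^-1` `[a, +oo[).
  apply: measurable_preimage => //; apply: measurableT_comp => //.
  exact: measurable_funB.
by apply/seteqP; split => x /=; rewrite in_itv /= andbT.
Qed.

(** By Chebyshev's inequality [L^2] approximation is approximation in measure, which
    preserves the three pointwise inequalities in the limit. *)
Lemma phaseMbar_simplex (r b : 'rV[R]_N -> R) : phaseMbar (r, b) -> ae_simplex r b.
Proof.
case=> /= Lr Lb H.
have mr := torus_L2_measurable Lr; have mb := torus_L2_measurable Lb.
have close (a e : R) : 0 < a -> 0 < e -> exists2 rb, phaseM rb &
    (mu [set x | (a <= `|r x - rb.1 x|)%R] <= e%:E)%E /\
    (mu [set x | (a <= `|b x - rb.2 x|)%R] <= e%:E)%E.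
  move=> a0 e0; have h0 : 0 < a * Num.sqrt e by rewrite mulr_gt0 // sqrtr_gt0.
  have [rb [L1 L2 h] [d1 d2]] := H _ h0; exists rb => //.
  have eq : (a * Num.sqrt e / a) ^+ 2 = e.
    by rewrite mulrAC mulfV ?mul1r ?sqr_sqrtr ?gt_eqF // ltW.
  have m1 := torus_L2_measurable L1; have m2 := torus_L2_measurable L2.
  by split; [have := torus_dist2_chebyshev a0 mr m1 d1|
             have := torus_dist2_chebyshev a0 mb m2 d2]; rewrite eq.
have r0 : \forall x \ae mu, 0 <= r x.
  apply: (ae_ge0_close_in_measure mr) => a e a0 e0.
  have [rb [L1 L2 h] [d1 d2]] := close a e a0 e0; exists rb.1.
    by apply: filterS h => x [/ltW].
  exists [set x | (a <= `|r x - rb.1 x|)%R]; last by split.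
  by apply: measurable_close_set => //; exact: torus_L2_measurable.
have b0 : \forall x \ae mu, 0 <= b x.
  apply: (ae_ge0_close_in_measure mb) => a e a0 e0.
  have [rb [L1 L2 h] [d1 d2]] := close a e a0 e0; exists rb.2.
    by apply: filterS h => x [_ /ltW].
  exists [set x | (a <= `|b x - rb.2 x|)%R]; last by split.
  by apply: measurable_close_set => //; exact: torus_L2_measurable.
have rb1 : \forall x \ae mu, 0 <= 1 - (r x + b x).
  apply: ae_ge0_close_in_measure; first exact: measurable_void.
  move=> a e a0 e0; have a2 : 0 < a / 2 by rewrite divr_gt0.
  have e2 : 0 < e / 2 by rewrite divr_gt0.
  have [rb [L1 L2 h] [d1 d2]] := close _ _ a2 e2.
  exists (fun x => 1 - (rb.1 x + rb.2 x)).
    by apply: filterS h => x [_ _ h]; rewrite subr_ge0 ltW.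
  have mB1 := @measurable_close_set r rb.1 (a / 2) mr (torus_L2_measurable L1).
  have mB2 := @measurable_close_set b rb.2 (a / 2) mb (torus_L2_measurable L2).
  exists ([set x | (a / 2 <= `|r x - rb.1 x|)%R] `|` [set x | (a / 2 <= `|b x - rb.2 x|)%R]).
    exact: measurableU.
  split; last first.
    apply: (le_trans (measureU2 _ mB1 mB2)).
    by apply: le_trans (leeD d1 d2) _; rewrite -EFinD lee_fin; lra.
  move=> x /= ax; have [h1|h1] := lerP (a / 2) `|r x - rb.1 x|; first by left.
  right; rewrite leNgt; apply/negP => h2; move: ax; rewrite leNgt => /negP; apply.
  rewrite (_ : _ - _ = - ((r x - rb.1 x) + (b x - rb.2 x))); last by ring.
  by rewrite normrN; apply: le_lt_trans (ler_normD _ _) _; lra.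
by apply: filterS3 r0 b0 rb1 => x ? ? ?; split => //; lra.
Qed.

Lemma simplex_phaseMbar (r b : 'rV[R]_N -> R) : torusL 2%:E r -> torusL 2%:E b ->
  ae_simplex r b -> phaseMbar (r, b).
Proof.
move=> Lr Lb S; split => //= e e0.
have mr := torus_L2_measurable Lr; have mb := torus_L2_measurable Lb.
have [pr pb] : periodic r /\ periodic b by case: Lr => ? _; case: Lb.
(* pull the pair towards the barycentre (1/3, 1/3) *)
pose d := Num.min 4^-1 (e / 4).
have d0 : 0 < d by rewrite lt_min invr_gt0 ltr0n divr_gt0.
have d1 : d <= 4^-1 by rewrite ge_min lexx.
have d2 : d <= e / 4 by rewrite ge_min lexx orbT.
pose h (u : 'rV[R]_N -> R) x := (1 - 3 * d) * u x + d.
have mh u : measurable_fun setT u -> measurable_fun setT (h u).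
  by move=> mu_; apply: measurable_funD => //; exact: measurable_funM.
have hL u : periodic u -> measurable_fun setT u -> (\forall x \ae mu, 0 <= u x <= 1) ->
    torusL 2%:E (h u) /\ (torus_dist 2%:E u (h u) < e%:E)%E.
  move=> pu mu_ u01; split.
    apply/torusLy_L2/(@torusLy_intro _ 1); last 2 first.
    - exact: mh.
    - apply: filterS u01 => x /andP[u0 u1]; rewrite /h ger0_norm; nra.
    - by move=> x z; rewrite /h pu.
  apply: (@le_lt_trans _ _ (2 * d)%:E); last by rewrite lte_fin; lra.
  apply: torus_dist2_le => //; [by rewrite mulr_ge0 // ltW|exact: mh|].
  apply: filterS u01 => x /andP[u0 u1]; rewrite /h ler_norml; apply/andP; split; nra.
have [Hr dr] : torusL 2%:E (h r) /\ (torus_dist 2%:E r (h r) < e%:E)%E.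
  by apply: hL => //; apply: filterS S => x [? ? ?]; apply/andP; split; lra.
have [Hb db] : torusL 2%:E (h b) /\ (torus_dist 2%:E b (h b) < e%:E)%E.
  by apply: hL => //; apply: filterS S => x [? ? ?]; apply/andP; split; lra.
exists (h r, h b) => //; split => //=.
apply: filterS S => x [? ? ?]; rewrite /h; split; nra.
Qed.

End Linfty.

(** * Comparison in time and paths of bounded functions *)

Section gronwall.
Context {R : realType}.

(** Here [b] and then [a] are values of a multiple of [exp ((L + 1) t)] at times [y]
    apart: over a short step the barrier still grows at the rate [L + 1/2] at
    least, relative to its final value. *)
Lemma barrier_growth (L y a b : R) : 0 <= L -> 0 < y -> 0 < a ->
  (L + 1) * ((L + 1) * y) <= 1 / 2 -> b * (1 + (L + 1) * y) <= a ->
  b + y * (L * a + a / 2) <= a.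
Proof.
move=> L0 y0 a0 small hb; set z := (L + 1) * y in small hb.
have z0 : 0 < z by rewrite mulr_gt0 //; lra.
have z1 : 0 < 1 + z by lra.
have k : y * ((1 + z) * (L + 1 / 2)) <= y * (L + 1) by rewrite ler_pM2l //; lra.
have ka : y * ((1 + z) * (L + 1 / 2)) * a <= y * (L + 1) * a by rewrite ler_pM2r.
by rewrite -(ler_pM2r z1); rewrite [y * (L + 1)]mulrC -/z in ka; lra.
Qed.

(** A Gronwall lemma for a function that need not be differentiable, such as the
    norm of a differentiable curve. If [E] were positive somewhere it would touch
    a small multiple of [exp ((L + 1) t)] from below at a first time, where the
    barrier grows strictly faster than [E] can. Only small values of [E] have to
    be controlled, so a local Lipschitz bound is enough in applications. *)
Lemma gronwall_first_contact (E : R -> R) (L T : R) : 0 <= L -> E 0 <= 0 ->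
  (forall t e, 0 <= t <= T -> 0 < e -> exists2 d, 0 < d &
     forall s, 0 <= s <= T -> `|s - t| < d -> `|E s - E t| <= e) ->
  (forall t e, 0 < t <= T -> E t <= 1 -> 0 < e -> exists2 d, 0 < d &
     forall s, 0 < s < t -> t - s < d -> E t - E s <= (t - s) * (L * E t + e)) ->
  forall t, 0 <= t <= T -> E t <= 0.
Proof.
move=> L0 E0 Ec Ed t1 /andP[t10 t1T]; rewrite leNgt; apply/negP => Et1.
pose X := expR ((L + 1) * T).
have X0 : 0 < X by exact: expR_gt0.
pose eps := Num.min 1 (E t1) / X.
have eps0 : 0 < eps by rewrite divr_gt0 // lt_min ltr01.
pose g t := eps * expR ((L + 1) * t).
have L1 : 0 < L + 1 by lra.
have g_gt0 t : 0 < g t by rewrite mulr_gt0 // expR_gt0.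
have g_nd s t : s <= t -> g s <= g t.
  by move=> st; rewrite ler_pM2l // ler_expR ler_pM2l.
have gT t : t <= T -> g t <= 1 /\ g t <= E t1.
  move=> /g_nd h; have : g T = Num.min 1 (E t1).
    by rewrite /g /eps -mulrA mulVf ?mulr1 // gt_eqF.
  by move=> e; rewrite e in h; split; apply: le_trans h _; rewrite ge_min lexx ?orbT.
pose S : set R := [set t | 0 <= t <= T /\ g t <= E t].
have S1 : S t1 by split; [rewrite t10|have [] := gT t1 t1T].
have Slb : lbound S 0 by move=> t [/andP[]].
have Sinf : has_inf S by split; [exists t1|exists 0].
pose tau := inf S.
have tau0 : 0 <= tau by apply: lb_le_inf => //; exists t1.
have tauT : tau <= T by apply: le_trans t1T; apply: ge_inf => //; exists 0.
have tauI : 0 <= tau <= T by rewrite tau0.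
have below s : 0 <= s -> s < tau -> E s < g s.
  move=> s0 st; rewrite ltNge; apply/negP => gE.
  have : S s by split => //; rewrite s0 (le_trans (ltW st)).
  have lb : has_lbound S by exists 0.
  by move=> /(ge_inf lb); rewrite leNgt st.
have Etau : g tau <= E tau.
  rewrite leNgt; apply/negP => Eg.
  have e0 : 0 < (g tau - E tau) / 2 by rewrite divr_gt0 // subr_gt0.
  have [d d0 H] := Ec tau _ tauI e0.
  have [s [sI gE] sd] := inf_adherent d0 Sinf.
  have ts : tau <= s by apply: ge_inf; [exists 0|split].
  have := H s sI; rewrite ger0_norm ?subr_ge0 // ltrBlDl => /(_ sd).
  have := g_nd _ _ ts; rewrite ler_norml => h /andP[_ h2]; lra.
have tau_gt0 : 0 < tau.
  rewrite lt_neqAle tau0 andbT; apply/eqP => t0.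
  by move: Etau; rewrite -t0 leNgt (le_lt_trans E0).
have Eg : E tau <= g tau.
  apply/ler_addgt0Pr => e e0; have [d d0 H] := Ec tau e tauI e0.
  pose s := Num.max 0 (tau - d / 2).
  have s0 : 0 <= s by rewrite le_max lexx.
  have st : s < tau by rewrite gt_max tau_gt0 /=; lra.
  have sI : 0 <= s <= T by rewrite s0 (le_trans (ltW st)).
  have sd : tau - d / 2 <= s by rewrite le_max lexx orbT.
  have := H s sI; rewrite ltr0_norm ?subr_lt0 // opprB => h.
  have {}h : `|E s - E tau| <= e by apply: h; lra.
  have := below s s0 st; have := g_nd _ _ (ltW st).
  move: h; rewrite ler_norml => /andP[h1 h2]; lra.
have [g1 _] := gT tau tauT.
have e0 : 0 < g tau / 2 by rewrite divr_gt0.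
have tauI' : 0 < tau <= T by rewrite tau_gt0.
have [d d0 H] := Ed tau _ tauI' (le_trans Eg g1) e0.
(* a step within the range of the growth bound on [E], and so short that
   [barrier_growth] applies *)
pose k := (2 * (L + 1) ^+ 2)^-1.
have k0 : 0 < k by rewrite invr_gt0 mulr_gt0 // exprn_gt0.
pose y := Num.min (tau / 2) (Num.min (d / 2) k).
have y0 : 0 < y by rewrite !lt_min !divr_gt0.
have y1 : y <= tau / 2 by rewrite ge_min lexx.
have y2 : y <= d / 2 by rewrite /y !ge_min lexx orbT.
have y3 : y <= k by rewrite /y !ge_min lexx !orbT.
have sI : 0 < tau - y < tau by apply/andP; split; lra.
have := H (tau - y) sI; rewrite subKr => Hy.
have {Hy}h1 : E tau - E (tau - y) <= y * (L * E tau + g tau / 2) by apply: Hy; lra.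
have h2 : E (tau - y) < g (tau - y) by apply: below; lra.
have h3 : g (tau - y) * (1 + (L + 1) * y) <= g tau.
  rewrite /g -mulrA ler_pM2l //; apply: le_trans (ler_wpM2l (expR_ge0 _) (expR_ge1Dx _)) _.
  by rewrite -expRD ler_expR -mulrDr subrK.
have h4 : (L + 1) * ((L + 1) * y) <= 1 / 2.
  have := ler_wpM2l (sqr_ge0 (L + 1)) y3.
  have -> : (L + 1) ^+ 2 * k = 1 / 2.
    by rewrite /k; field; rewrite gt_eqF.
  by rewrite expr2 mulrA.
have := barrier_growth L0 y0 (g_gt0 tau) h4 h3.
rewrite leNgt => /negP; apply; apply: le_lt_trans Etau _; rewrite addrC -ltrBlDl.
apply: le_lt_trans _ h2; rewrite lerBlDl -lerBlDr; apply: le_trans h1 _.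
by rewrite ler_pM2l // lerD2r ler_wpM2l.
Qed.

End gronwall.

Section Linfty_paths.
Context {R : realType} {N : nat}.
Local Notation mu := (@torus_measure R N).
Implicit Types (w : R -> 'rV[R]_N -> R) (A : set R).

Lemma cvge0_le_dist (G : set_system R) (f : R -> \bar R) (B t : R) : Filter G ->
  nbhs t `<=` G -> (forall s, (0 <= f s)%E) ->
  (\forall s \near G, (f s <= (B * `|s - t|)%:E)%E) -> f s @[s --> G] --> 0%E.
Proof.
move=> FG tG f0 fB.
have h : (B * `|s - t|)%:E @[s --> G] --> 0%E.
  apply: (@cvg_trans _ ((B * `|s - t|)%:E @[s --> t])); first by move=> P /tG.
  have c : B * `|s - t| @[s --> t] --> B * `|t - t|.
    apply: cvgM; first exact: cvg_cst.
    by apply: cvg_norm; apply: cvgB; [exact: cvg_id|exact: cvg_cst].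
  rewrite subrr normr0 mulr0 in c.
  exact: (@cvg_EFin R R (nbhs t) _ (fun s => (B * `|s - t|)%:E) 0 (nearW _ _) c).
apply: squeeze_cvge (cvg_cst 0%E) h.
by apply: filterS fB => s ->; rewrite f0.
Qed.

Lemma Linfty_continuous_lipschitz A w (B : R) :
  (forall t, A t -> torusL +oo (w t)) ->
  (forall s t x, A s -> A t -> `|w s x - w t x| <= B * `|s - t|) ->
  Linfty_continuous A w.
Proof.
move=> Lw lip; split => // t At; apply: (@cvge0_le_dist _ _ B t).
- by move=> P Pt; apply: filterS Pt => s Ps _.
- by move=> s; exact: torus_dist_ge0.
- rewrite near_withinE; apply: filterE => s As; apply/torus_dist_leP; apply: aeW => x.
  exact: lip.
Qed.

Lemma Linfty_derivative_expansion A w w' (B : R) :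
  (forall s t x, A s -> A t -> s != t ->
     `|(w s x - w t x) / (s - t) - w' t x| <= B * `|s - t|) ->
  Linfty_derivative A w w'.
Proof.
move=> lip t At; apply: (@cvge0_le_dist _ _ B t).
- by move=> P Pt; apply: filterS Pt => s Ps _ _.
- by move=> s; exact: torus_dist_ge0.
- rewrite !near_withinE; apply: filterE => s st As.
  by apply/torus_dist_leP; apply: aeW => x; exact: lip.
Qed.

Lemma Linfty_continuousP A w t (e : R) : Linfty_continuous A w -> A t -> 0 < e ->
  exists2 d, 0 < d & forall s, A s -> `|s - t| < d ->
    \forall x \ae mu, `|w s x - w t x| <= e.
Proof.
move=> [_ cw] At e0.
have : \forall s \near within A (nbhs t), (torus_dist +oo (w s) (w t) < e%:E)%E.
  by apply: (cw t At [set y | (y < e%:E)%E]); apply: open_ereal_lt'; rewrite lte_fin.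
rewrite near_withinE => /nbhs_ballP [d d0 H]; exists d => // s As st.
by apply/torus_dist_leP/ltW/H => //; rewrite -ball_normE /= distrC.
Qed.

Lemma Linfty_derivativeP A w w' t (e : R) : Linfty_derivative A w w' -> A t -> 0 < e ->
  exists2 d, 0 < d & forall s, A s -> s != t -> `|s - t| < d ->
    \forall x \ae mu, `|(w s x - w t x) / (s - t) - w' t x| <= e.
Proof.
move=> dw At e0.
have : \forall s \near within A t^',
    (torus_dist +oo (fun x => ((w s x - w t x) / (s - t))%R) (w' t) < e%:E)%E.
  by apply: (dw t At [set y | (y < e%:E)%E]); apply: open_ereal_lt'; rewrite lte_fin.
rewrite !near_withinE => /nbhs_ballP [d d0 H]; exists d => // s As st sd.
by apply/torus_dist_leP/ltW/H => //; rewrite -ball_normE /= distrC.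
Qed.

Definition sup_dist (u v : 'rV[R]_N -> R) : R := fine (torus_dist +oo u v).

Lemma sup_dist_ub u v : torusL +oo u -> torusL +oo v ->
  \forall x \ae mu, `|u x - v x| <= sup_dist u v.
Proof.
move=> /torusLy_bounded[a ua] /torusLy_bounded[b vb].
apply/torus_dist_leP; rewrite fineK // ge0_fin_numE ?torus_dist_ge0 //.
apply: (@le_lt_trans _ _ (a + b)%:E); last exact: ltry.
apply/torus_dist_leP; apply: filterS2 ua vb => x ua vb.
by apply: le_trans (ler_normB _ _) _; exact: lerD.
Qed.

Lemma sup_dist_le u v (e : R) : (\forall x \ae mu, `|u x - v x| <= e) -> sup_dist u v <= e.
Proof.
move=> /torus_dist_leP h; rewrite -lee_fin fineK //.
rewrite ge0_fin_numE ?torus_dist_ge0 //; exact: le_lt_trans h (ltry _).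
Qed.

End Linfty_paths.

(** * Existence in the simplex *)

Section admissible_kernels.
Context {R : realType} {N : nat}.
Implicit Types (K : 'rV[R]_N -> R) (x y : 'rV[R]_N).

Lemma admissible_integrable K : admissible K ->
  (lebesgue_rV R N).-integrable setT (EFin \o K).
Proof. by case=> -[/Lfun1_integrable]. Qed.

Lemma enorm_gt0 x : x != 0 -> 0 < enorm x.
Proof.
move=> x0; rewrite /enorm sqrtr_gt0 lt_neqAle sumr_ge0 ?andbT; last first.
  by move=> i _; exact: sqr_ge0.
apply: contra x0 => /eqP/esym/eqP; rewrite psumr_eq0; last by move=> i _; exact: sqr_ge0.
move=> /allP h; apply/eqP/rowP => i; rewrite mxE.
by have := h i (mem_index_enum _); rewrite /= sqrf_eq0 => /eqP.
Qed.

Lemma admissible_ge0 K y : admissible K -> y != 0 -> 0 <= K y.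
Proof. by move=> [_ [k [Kk k0 _ _]]] y0; rewrite Kk // ltW // k0 // enorm_gt0. Qed.

End admissible_kernels.

Section dynamics.
Context {R : realType} {N : nat}.
Hypothesis N_gt0 : (0 < N)%N.
Local Notation leb := (lebesgue_rV R N).
Local Notation mu := (@torus_measure R N).
Variable K : 'rV[R]_N -> R.
Hypothesis iK : leb.-integrable setT (EFin \o K).
Hypothesis K_ge0 : forall y, y != 0 -> 0 <= K y.
Variables (m l : R) (Dr Db : R -> R -> R).
Hypotheses (m0 : 0 <= m) (l0 : 0 <= l).
Hypotheses (tDr : tame_mobility m l Dr) (tDb : tame_mobility m l Db).
Local Notation kappa := (kernel_mass K).

Let L := kappa * (18 * m + 20 * l).
Let M := kappa * m.

Let L_ge0 : 0 <= L.
Proof. by rewrite mulr_ge0 ?kernel_mass_ge0 // addr_ge0 // mulr_ge0. Qed.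

Let M_ge0 : 0 <= M.
Proof. by rewrite mulr_ge0 ?kernel_mass_ge0. Qed.

(** The pair of densities is encoded as one function on two copies of the space,
    [true] for [r] and [false] for [b], so that the Euler scheme applies to it. *)
Definition component (c : bool) (U : bool * 'rV[R]_N -> R) : 'rV[R]_N -> R :=
  fun x => U (c, x).

Definition simplex_state (U : bool * 'rV[R]_N -> R) : Prop :=
  [/\ forall c, measurable_fun setT (component c U), forall c, periodic (component c U) &
      forall x, [/\ 0 <= U (true, x), 0 <= U (false, x) & U (true, x) + U (false, x) <= 1]].

Definition mobility_of (c : bool) := if c then Dr else Db.

Definition velocity (U : bool * 'rV[R]_N -> R) (p : bool * 'rV[R]_N) : R :=
  flux K (mobility_of p.1) (component true U) (component false U) (component p.1 U) p.2.

Let tame_mobility_of c : tame_mobility m l (mobility_of c). Proof. by case: c. Qed.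

Lemma simplex_state01 U c x : simplex_state U -> 0 <= U (c, x) <= 1.
Proof. by case=> _ _ /(_ x) [? ? ?]; case: c; apply/andP; split; lra. Qed.

Lemma simplex_state_box U c x : simplex_state U ->
  box2 (component true U) (component false U) (component c U) x.
Proof.
move=> sU; have h c' : `|component c' U x| <= 2.
  by have /andP[? ?] := simplex_state01 c' x sU; rewrite /component ger0_norm //; lra.
by split.
Qed.

Lemma velocity_lipschitz U V (e : R) : simplex_state U -> simplex_state V -> 0 <= e ->
  (forall p, `|U p - V p| <= e) -> forall p, `|velocity U p - velocity V p| <= L * e.
Proof.
move=> sU sV e0 UVe [c x].
have [mU _ _] := sU; have [mV _ _] := sV.
apply: (flux_lipschitz iK m0 l0 (tame_mobility_of c) e0) => //.
- by apply: aeW => y; exact: simplex_state_box.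
- by apply: aeW => y; exact: simplex_state_box.
- by apply: aeW => y; split; exact: UVe.
- exact: simplex_state_box.
- exact: simplex_state_box.
- by split; exact: UVe.
Qed.

Lemma velocity_bounds U c x : simplex_state U ->
  exists A B, [/\ velocity U (c, x) = (1 - (U (true, x) + U (false, x))) * A - U (c, x) * B,
    0 <= A <= M & 0 <= B <= M].
Proof.
move=> sU; have [mU _ sx] := sU.
have [A [B [d [E hA /andP[B0 B1] /andP[d0 d1]]]]] := 
  flux_simplex iK m0 (tame_mobility_of c) x N_gt0 K_ge0
  (mU true) (mU false) (mU c) sx (fun y => simplex_state01 c y sU).
exists A, (d * B); split => //.
  by rewrite /velocity E /component /=; ring.
by rewrite mulr_ge0 //= /M mulrC ler_pM.
Qed.

Lemma velocity_le U : simplex_state U -> forall p, `|velocity U p| <= M.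
Proof.
move=> sU [c x]; have [A [B [-> /andP[A0 A1] /andP[B0 B1]]]] := velocity_bounds c x sU.
have /andP[u0 u1] := simplex_state01 c x sU.
have [_ _ /(_ x) [r0 b0 rb1]] := sU.
by rewrite ler_norml; apply/andP; split; nra.
Qed.

Lemma measurable_velocity U c : simplex_state U -> measurable_fun setT (component c (velocity U)).
Proof.
by move=> [mU _ _]; exact: (measurable_flux iK (tame_mobility_of c) (mU true) (mU false) (mU c)).
Qed.

Lemma periodic_velocity U c : simplex_state U -> periodic (component c (velocity U)).
Proof.
move=> sU; have [mU pU _] := sU.
apply: (periodic_flux iK m0 (tame_mobility_of c) (mU true) (mU false) (mU c)) => //.
by apply: aeW => y; exact: simplex_state_box.
Qed.

(** The simplex is invariant under short Euler steps: a density can decrease at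
    most proportionally to itself, and the total density can increase at most
    proportionally to the void [1 - rho]. *)
Lemma simplex_state_step U (h : R) : simplex_state U -> 0 <= h <= (2 * M + 1)^-1 ->
  simplex_state (fun p => U p + h * velocity U p).
Proof.
move=> sU /andP[h0 h1]; have [mU pU _] := sU.
have hM : h * (2 * M) <= 1.
  have M1 : 0 < 2 * M + 1 by rewrite ltr_wpDl // mulr_ge0.
  by move: h1; rewrite -[X in _ <= X]mul1r ler_pdivlMr // mulrDr mulr1 => h1; lra.
split.
- move=> c; apply: measurable_funD; first exact: mU.
  by apply: measurable_funM => //; exact: measurable_velocity.
- move=> c x z; rewrite /component; congr (_ + _ * _); first exact: (pU c).
  exact: (periodic_velocity c sU).
- move=> x; have [_ _ /(_ x) [r0 b0 rb1]] := sU.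
  have [A [B [-> /andP[A0 A1] /andP[B0 B1]]]] := velocity_bounds true x sU.
  have [A' [B' [-> /andP[A0' A1'] /andP[B0' B1']]]] := velocity_bounds false x sU.
  set r := U (true, x) in r0 rb1 *; set b := U (false, x) in b0 rb1 *.
  have v0 : 0 <= 1 - (r + b) by lra.
  have hB : h * B <= 1 by nra.
  have hB' : h * B' <= 1 by nra.
  have hA : h * (A + A') <= 1 by nra.
  have hA0 : 0 <= h * A by rewrite mulr_ge0.
  have hA0' : 0 <= h * A' by rewrite mulr_ge0.
  have hB0 : 0 <= h * B by rewrite mulr_ge0.
  have hB0' : 0 <= h * B' by rewrite mulr_ge0.
  have k1 : 0 <= r * (1 - h * B) by rewrite mulr_ge0 // subr_ge0.
  have k2 : 0 <= b * (1 - h * B') by rewrite mulr_ge0 // subr_ge0.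
  have k3 : 0 <= (1 - (r + b)) * (1 - h * (A + A')) by rewrite mulr_ge0 // subr_ge0.
  have k4 : 0 <= (1 - (r + b)) * (h * A) by rewrite mulr_ge0.
  have k5 : 0 <= (1 - (r + b)) * (h * A') by rewrite mulr_ge0.
  have k6 : 0 <= r * (h * B) by rewrite mulr_ge0.
  have k7 : 0 <= b * (h * B') by rewrite mulr_ge0.
  by split; lra.
Qed.

Lemma simplex_state_closed (W : nat -> bool * 'rV[R]_N -> R) U :
  (forall n, simplex_state (W n)) -> (forall p, W n p @[n --> \oo] --> U p) ->
  simplex_state U.
Proof.
move=> sW WU; split.
- move=> c; apply: (@measurable_fun_cvg _ _ _ _ (fun n => component c (W n))).
    by move=> n; have [mW _ _] := sW n; exact: mW.
  by move=> x _; exact: WU.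
- move=> c x z; apply: (cvg_unique _ (WU (c, x + map_mx intr z))) => //.
  rewrite (_ : (fun n => _) = (fun n => W n (c, x))); first exact: WU.
  by apply/funext => n; have [_ pW _] := sW n; exact: (pW c).
- move=> x; split.
  + apply: (ler_cvg_to (cvg_cst 0) (WU (true, x))); apply: nearW => n.
    by have [_ _ /(_ x) []] := sW n.
  + apply: (ler_cvg_to (cvg_cst 0) (WU (false, x))); apply: nearW => n.
    by have [_ _ /(_ x) []] := sW n.
  + have WUD : W n (true, x) + W n (false, x) @[n --> \oo] --> U (true, x) + U (false, x).
      by apply: cvgD; exact: WU.
    have c1 : (1 : R) @[n --> \oo] --> (1 : R) by exact: cvg_cst.
    by apply: (ler_cvg_to WUD c1); apply: nearW => n; have [_ _ /(_ x) []] := sW n.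
Qed.

Lemma simplex_flow (U0 : bool * 'rV[R]_N -> R) (T : R) : simplex_state U0 ->
  exists U : R -> bool * 'rV[R]_N -> R,
  [/\ U 0 = U0, forall t, 0 <= t <= T -> simplex_state (U t) &
      forall s t p, 0 <= s -> s <= t -> t <= T ->
        `|U t p - U s p - (t - s) * velocity (U s) p| <= L * M * (t - s) ^+ 2].
Proof.
move=> sU0.
have h0 : 0 < (2 * M + 1)^-1 by rewrite invr_gt0 ltr_wpDl // mulr_ge0.
exact: (euler_flow L_ge0 M_ge0 h0 velocity_lipschitz velocity_le simplex_state_step
  simplex_state_closed sU0).
Qed.

Lemma simplex_state_torusLy U c : simplex_state U -> torusL +oo (component c U).
Proof.
move=> sU; have [mU pU _] := sU; apply: (@torusLy_intro _ _ _ 1) => //.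
apply: aeW => x; have /andP[u0 u1] := simplex_state01 c x sU.
by rewrite /component ger0_norm.
Qed.

Lemma velocity_torusLy U c : simplex_state U -> torusL +oo (component c (velocity U)).
Proof.
move=> sU; apply: (@torusLy_intro _ _ _ M).
- exact: periodic_velocity.
- exact: measurable_velocity.
- by apply: aeW => x; exact: velocity_le.
Qed.

(** The flow of [simplex_flow] obeys estimates at every point, uniform in space, and
    these imply the corresponding statements about essential suprema. *)
Lemma simplex_solution (rI bI : 'rV[R]_N -> R) (T : R) :
  torusL 2%:E rI -> torusL 2%:E bI -> ae_simplex rI bI -> 0 < T ->
  exists r b, is_solution K Dr Db rI bI T r b /\
    forall t x, 0 <= t <= T -> [/\ 0 <= r t x, 0 <= b t x & r t x + b t x <= 1].
Proof.
move=> LrI LbI S T0.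
have mr := torus_L2_measurable LrI; have mb := torus_L2_measurable LbI.
have [pr pb] : periodic rI /\ periodic bI by case: LrI => ? _; case: LbI.
(* a representative of the initial data that lies in the simplex everywhere *)
pose r0 x := Num.max 0 (Num.min (rI x) 1).
pose b0 x := Num.max 0 (Num.min (bI x) (1 - r0 x)).
have mr0 : measurable_fun setT r0.
  by apply: measurable_maxr => //; exact: measurable_minr.
have mb0 : measurable_fun setT b0.
  apply: measurable_maxr => //; apply: measurable_minr => //.
  exact: measurable_funB.
pose U0 (p : bool * 'rV[R]_N) := if p.1 then r0 p.2 else b0 p.2.
have sU0 : simplex_state U0.
  have r01 x : 0 <= r0 x <= 1.
    by rewrite le_max lexx /= ge_max ler01 ge_min lexx orbT.
  split.
  - by case.
  - by case => x z; rewrite /component /U0 /b0 /r0 /= ?pr ?pb.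
  - move=> x; rewrite /U0 /=; have /andP[r1 r2] := r01 x.
    split => //; first by rewrite le_max lexx.
    rewrite -lerBrDl ge_max subr_ge0 r2 /= ge_min lexx orbT //.
have [U [U0E UC UE]] := simplex_flow T sU0.
pose B := M + L * M * T.
have LM0 : 0 <= L * M by rewrite mulr_ge0.
have B0 : 0 <= B by rewrite addr_ge0 // mulr_ge0 // ltW.
have lip s t p : 0 <= s <= T -> 0 <= t <= T -> `|U s p - U t p| <= B * `|s - t|.
  wlog st : s t / s <= t => [H hs ht|/andP[s0 sT] /andP[t0 tT]].
    have [|/ltW] := leP s t; first by move=> h; exact: H.
    by move=> h; rewrite distrC [`|s - t|]distrC; exact: H.
  have e := UE s t p s0 st tT.
  have v : `|velocity (U s) p| <= M by apply: velocity_le; apply: UC; rewrite s0.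
  rewrite distrC [`|s - t|]distrC (ger0_norm (_ : 0 <= t - s)) ?subr_ge0 //.
  set d := t - s in e *; have d0 : 0 <= d by rewrite subr_ge0.
  have dT : d <= T by rewrite /d; lra.
  move: e v; rewrite !ler_norml => /andP[e1 e2] /andP[v1 v2].
  have k1 : d * velocity (U s) p <= d * M by rewrite ler_wpM2l.
  have k2 : d * - M <= d * velocity (U s) p by rewrite ler_wpM2l.
  have k3 : L * M * d ^+ 2 <= L * M * (T * d) by rewrite ler_wpM2l // expr2 ler_wpM2r.
  by rewrite /B; apply/andP; split; lra.
have vlip s t p : 0 <= s <= T -> 0 <= t <= T ->
    `|velocity (U s) p - velocity (U t) p| <= L * B * `|s - t|.
  move=> hs ht; rewrite -mulrA; apply: velocity_lipschitz; [exact: UC|exact: UC| |].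
    by rewrite mulr_ge0.
  by move=> p'; exact: lip.
have der s t p : 0 <= s <= T -> 0 <= t <= T -> s != t ->
    `|(U s p - U t p) / (s - t) - velocity (U t) p| <= (L * M + L * B) * `|s - t|.
  have one a c : 0 <= a <= T -> 0 <= c <= T -> a < c ->
      `|(U c p - U a p) / (c - a) - velocity (U a) p| <= L * M * (c - a).
    move=> /andP[a0 aT] /andP[c0 cT] ac.
    have ca : 0 < c - a by rewrite subr_gt0.
    have := UE a c p a0 (ltW ac) cT.
    rewrite (_ : _ - _ - _ = ((U c p - U a p) / (c - a) - velocity (U a) p) * (c - a)).
      by rewrite normrM (gtr0_norm ca) expr2 mulrA ler_pM2r.
    by field; rewrite gt_eqF.
  move=> hs ht; rewrite neq_lt => /orP[st|ts].
    have -> : (U s p - U t p) / (s - t) = (U t p - U s p) / (t - s).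
      by rewrite -[s - t]opprB invrN mulrN -mulNr opprB.
    have h1 := one s t hs ht st; have h2 := vlip s t p hs ht.
    rewrite (_ : _ - _ = ((U t p - U s p) / (t - s) - velocity (U s) p) +
      (velocity (U s) p - velocity (U t) p)); last by rewrite subrKA.
    apply: le_trans (ler_normD _ _) _; rewrite [leRHS]mulrDl lerD //.
    by rewrite [`|s - t|]ltr0_norm ?subr_lt0 // [- (s - t)]opprB.
  have h1 := one t s ht hs ts; rewrite [`|s - t|]gtr0_norm ?subr_gt0 //.
  apply: le_trans h1 _; rewrite ler_pM2r ?subr_gt0 // lerDl.
  by rewrite mulr_ge0.
pose w c t := component c (U t); pose w' c t := component c (velocity (U t)).
have oc t : t \in `]0, T] -> 0 <= t <= T.
  by rewrite in_itv /= => /andP[/ltW -> ->].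
have wc c : Linfty_continuous `[0, T] (w c).
  apply: (@Linfty_continuous_lipschitz _ _ _ _ B).
    by move=> t; rewrite /= in_itv => tT; apply: simplex_state_torusLy; exact: UC.
  by move=> s t x; rewrite /= !in_itv /=; exact: lip.
have wC1 c : Linfty_C1 `]0, T] (w c) (w' c).
  split.
  - apply: (@Linfty_continuous_lipschitz _ _ _ _ B).
      by move=> t /oc tT; apply: simplex_state_torusLy; exact: UC.
    by move=> s t x /oc hs /oc ht; exact: lip.
  - apply: (@Linfty_continuous_lipschitz _ _ _ _ (L * B)).
      by move=> t /oc tT; apply: velocity_torusLy; exact: UC.
    by move=> s t x /oc hs /oc ht; exact: vlip.
  - apply: (@Linfty_derivative_expansion _ _ _ _ _ (L * M + L * B)).
    by move=> s t x /oc hs /oc ht; exact: der.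
exists (w true), (w false); split; last first.
  by move=> t x tT; have [_ _ /(_ x)] := UC t tT.
split => //.
  by exists (w' true), (w' false); split => // t _; split; exact: aeW.
rewrite /w U0E; split; apply: filterS S => x [h1 h2 h3] _; rewrite /component /U0 /b0 /r0 /=.
  by rewrite min_l ?max_r //; lra.
by rewrite [Num.min (rI x) 1]min_l ?max_r ?min_l //; lra.
Qed.

End dynamics.

(** * Uniqueness and the theorem *)

Section perturbation.
Context {R : realType}.
Implicit Types a c v E e : R.

Lemma ler_norm_perturb a a' c c' E e : `|a - a'| <= E -> `|c - a| <= e / 2 ->
  `|c' - a'| <= e / 2 -> `|c - c'| <= E + e.
Proof.
rewrite !ler_norml => /andP[? ?] /andP[? ?] /andP[? ?].
by apply/andP; split; lra.
Qed.

Lemma ler_norm_near1 a a' E : `|a'| <= 1 -> `|a - a'| <= E -> E <= 1 -> `|a| <= 2.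
Proof.
rewrite !ler_norml => /andP[? ?] /andP[? ?] ?.
by apply/andP; split; lra.
Qed.

Lemma simplex_le1 a c : 0 <= a -> 0 <= c -> a + c <= 1 -> `|a| <= 1 /\ `|c| <= 1.
Proof. by move=> a0 c0 ac; split; rewrite ger0_norm //; lra. Qed.

(** One step of an error estimate backwards in time: the difference quotients at
    [t] are within [e / 2] of the velocities [v] and [v']. *)
Lemma ler_norm_backward_step (s t : R) a a' c c' v v' E G e : s < t ->
  `|a - a'| <= E ->
  `|(a - c) / (s - t) - v| <= e / 2 -> `|(a' - c') / (s - t) - v'| <= e / 2 ->
  `|v - v'| <= G -> `|c - c'| <= E + (t - s) * (G + e).
Proof.
move=> st aE hq hq' hv; have ts : 0 < t - s by rewrite subr_gt0.
have stN : s - t != 0 by rewrite subr_eq0 lt_eqF.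
set q := (a - c) / (s - t) - v in hq; set q' := (a' - c') / (s - t) - v' in hq'.
have -> : c - c' = (a - a') + (t - s) * ((v - v') + (q - q')).
  by rewrite /q /q'; field.
apply: le_trans (ler_normD _ _) _; rewrite lerD // normrM (gtr0_norm ts) ler_pM2l //.
apply: le_trans (ler_normD _ _) _; rewrite lerD //.
by apply: le_trans (ler_normB _ _) _; lra.
Qed.

End perturbation.

Section uniqueness.
Context {R : realType} {N : nat}.
Local Notation leb := (lebesgue_rV R N).
Local Notation mu := (@torus_measure R N).
Variable K : 'rV[R]_N -> R.
Hypothesis iK : leb.-integrable setT (EFin \o K).
Variables (m l : R) (Dr Db : R -> R -> R).
Hypotheses (m0 : 0 <= m) (l0 : 0 <= l).
Hypotheses (tDr : tame_mobility m l Dr) (tDb : tame_mobility m l Db).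
Local Notation kappa := (kernel_mass K).

Let L := kappa * (18 * m + 20 * l).

(** The convolutions see the whole space, so the bounds known almost everywhere on
    the torus are first extended by periodicity. *)
Lemma flux_ae_lipschitz D (e : R) (r b w r' b' w' : 'rV[R]_N -> R) :
  tame_mobility m l D -> 0 <= e ->
  torusL +oo r -> torusL +oo b -> torusL +oo w ->
  torusL +oo r' -> torusL +oo b' -> torusL +oo w' ->
  (\forall x \ae mu, box2 r b w x) -> (\forall x \ae mu, box2 r' b' w' x) ->
  (\forall x \ae mu, close3 e r b w r' b' w' x) ->
  \forall x \ae mu, `|flux K D r b w x - flux K D r' b' w' x| <= L * e.
Proof.
move=> tD e0 Lr Lb Lw Lr' Lb' Lw' B B' Cl.
have [pr pb pw] : [/\ periodic r, periodic b & periodic w].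
  by case: Lr => ? _; case: Lb => ? _; case: Lw.
have [pr' pb' pw'] : [/\ periodic r', periodic b' & periodic w'].
  by case: Lr' => ? _; case: Lb' => ? _; case: Lw'.
have lB : \forall x \ae leb, box2 r b w x.
  by apply: torus_ae_lift B => x z; rewrite /box2 pr pb pw.
have lB' : \forall x \ae leb, box2 r' b' w' x.
  by apply: torus_ae_lift B' => x z; rewrite /box2 pr' pb' pw'.
have lC : \forall x \ae leb, close3 e r b w r' b' w' x.
  by apply: torus_ae_lift Cl => x z; rewrite /close3 pr pb pw pr' pb' pw'.
apply: filterS3 B B' Cl => x Bx Bx' Cx.
by apply: (flux_lipschitz iK m0 l0 tD) => //; exact: torusLy_measurable.
Qed.

(** Any solution coincides with one that stays in the simplex: as long as they
    are at distance at most 1 both lie in the box where the flux is Lipschitz. *)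
Lemma solution_unique (rI bI : 'rV[R]_N -> R) (T : R) (r b r' b' : R -> 'rV[R]_N -> R) :
  is_solution K Dr Db rI bI T r b -> is_solution K Dr Db rI bI T r' b' ->
  (forall t x, 0 <= t <= T -> [/\ 0 <= r' t x, 0 <= b' t x & r' t x + b' t x <= 1]) ->
  forall t, 0 <= t <= T -> r t = r' t %[ae mu] /\ b t = b' t %[ae mu].
Proof.
case=> cr cb [vr [vb [C1r C1b eqn]]] [r0 b0].
case=> cr' cb' [vr' [vb' [C1r' C1b' eqn']]] [r0' b0'] S.
have in01 t : 0 <= t <= T -> `[0, T]%classic t by rewrite /= in_itv.
have inoc t : 0 < t <= T -> `]0, T]%classic t by rewrite /= in_itv.
have Lr t : 0 <= t <= T -> torusL +oo (r t) by move=> /in01; case: cr => h _; exact: h.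
have Lb t : 0 <= t <= T -> torusL +oo (b t) by move=> /in01; case: cb => h _; exact: h.
have Lr' t : 0 <= t <= T -> torusL +oo (r' t) by move=> /in01; case: cr' => h _; exact: h.
have Lb' t : 0 <= t <= T -> torusL +oo (b' t) by move=> /in01; case: cb' => h _; exact: h.
pose E t := Num.max (sup_dist (r t) (r' t)) (sup_dist (b t) (b' t)).
have E_le t e : (\forall x \ae mu, `|r t x - r' t x| <= e) ->
    (\forall x \ae mu, `|b t x - b' t x| <= e) -> E t <= e.
  by move=> h1 h2; rewrite ge_max !sup_dist_le.
have E_r t : 0 <= t <= T -> \forall x \ae mu, `|r t x - r' t x| <= E t.
  move=> tT; apply: filterS (sup_dist_ub (Lr t tT) (Lr' t tT)) => x h.
  by rewrite (le_trans h) // le_max lexx.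
have E_b t : 0 <= t <= T -> \forall x \ae mu, `|b t x - b' t x| <= E t.
  move=> tT; apply: filterS (sup_dist_ub (Lb t tT) (Lb' t tT)) => x h.
  by rewrite (le_trans h) // le_max lexx orbT.
have E_ge0 t : 0 <= t <= T -> 0 <= E t.
  move=> tT; have [x h] := ae_torus_exists (E_r t tT).
  exact: le_trans (normr_ge0 _) h.
have L0 : 0 <= L by rewrite mulr_ge0 ?kernel_mass_ge0 // addr_ge0 // mulr_ge0.
suff E0 t : 0 <= t <= T -> E t <= 0.
  move=> t tT; split; [apply: filterS (E_r t tT)|apply: filterS (E_b t tT)];
  by move=> x h _; apply/eqP; rewrite -subr_eq0 -normr_le0 (le_trans h) // E0.
move: t; apply: (@gronwall_first_contact _ E L T) => //.
- apply: E_le; [apply: filterS2 r0 r0'|apply: filterS2 b0 b0'];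
  by move=> x h h'; rewrite h // h' // subrr normr0.
- move=> t e tT e0; have e2 : 0 < e / 2 by rewrite divr_gt0.
  have [d1 d10 H1] := Linfty_continuousP cr (in01 _ tT) e2.
  have [d2 d20 H2] := Linfty_continuousP cb (in01 _ tT) e2.
  have [d3 d30 H3] := Linfty_continuousP cr' (in01 _ tT) e2.
  have [d4 d40 H4] := Linfty_continuousP cb' (in01 _ tT) e2.
  exists (Num.min (Num.min d1 d2) (Num.min d3 d4)); first by rewrite !lt_min d10 d20 d30.
  move=> s sT; rewrite !lt_min => /andP[/andP[sd1 sd2] /andP[sd3 sd4]].
  have h1 := H1 s (in01 _ sT) sd1; have h2 := H2 s (in01 _ sT) sd2.
  have h3 := H3 s (in01 _ sT) sd3; have h4 := H4 s (in01 _ sT) sd4.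
  have k1 : E s <= E t + e.
    apply: E_le; [apply: filterS3 (E_r t tT) h1 h3|apply: filterS3 (E_b t tT) h2 h4];
    by move=> x; exact: ler_norm_perturb.
  have k2 : E t <= E s + e.
    apply: E_le; [apply: filterS3 (E_r s sT) h1 h3|apply: filterS3 (E_b s sT) h2 h4];
    by move=> x hE h h'; apply: (ler_norm_perturb hE); rewrite distrC.
  by rewrite ler_distl lerBlDr k1 k2.
- move=> t e tT Et1 e0; have e2 : 0 < e / 2 by rewrite divr_gt0.
  have tI : 0 <= t <= T by case/andP: tT => /ltW -> ->.
  have [[_ _ dr] [_ _ db]] := (C1r, C1b); have [[_ _ dr'] [_ _ db']] := (C1r', C1b').
  have [d1 d10 H1] := Linfty_derivativeP dr (inoc _ tT) e2.
  have [d2 d20 H2] := Linfty_derivativeP db (inoc _ tT) e2.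
  have [d3 d30 H3] := Linfty_derivativeP dr' (inoc _ tT) e2.
  have [d4 d40 H4] := Linfty_derivativeP db' (inoc _ tT) e2.
  exists (Num.min (Num.min d1 d2) (Num.min d3 d4)); first by rewrite !lt_min d10 d20 d30.
  move=> s /andP[s0 st]; rewrite !lt_min => /andP[/andP[sd1 sd2] /andP[sd3 sd4]].
  have ts : 0 < t - s by rewrite subr_gt0.
  have sT : 0 < s <= T by rewrite s0 (le_trans (ltW st)) //; case/andP: tI.
  have sI : 0 <= s <= T by rewrite ltW //; case/andP: sT.
  have nst : s != t by rewrite lt_eqF.
  have dst : `|s - t| = t - s by rewrite ltr0_norm ?subr_lt0 // opprB.
  rewrite -dst in sd1 sd2 sd3 sd4.
  have h1 := H1 s (inoc _ sT) nst sd1; have h2 := H2 s (inoc _ sT) nst sd2.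
  have h3 := H3 s (inoc _ sT) nst sd3; have h4 := H4 s (inoc _ sT) nst sd4.
  have [er eb] := eqn t tT; have [er' eb'] := eqn' t tT.
  have box' x : `|r' t x| <= 1 /\ `|b' t x| <= 1.
    by have [r0x b0x rbx] := S t x tI; exact: simplex_le1.
  have Br : \forall x \ae mu, `|r t x| <= 2.
    apply: filterS (E_r t tI) => x h; have [k _] := box' x; exact: ler_norm_near1 k h Et1.
  have Bb : \forall x \ae mu, `|b t x| <= 2.
    apply: filterS (E_b t tI) => x h; have [_ k] := box' x; exact: ler_norm_near1 k h Et1.
  have box2' x : `|r' t x| <= 2 /\ `|b' t x| <= 2.
    by have [k k'] := box' x; split; apply: le_trans (ler1n R 2).
  have fr := flux_ae_lipschitz tDr (E_ge0 t tI) (Lr t tI) (Lb t tI) (Lr t tI)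
    (Lr' t tI) (Lb' t tI) (Lr' t tI).
  have fb := flux_ae_lipschitz tDb (E_ge0 t tI) (Lr t tI) (Lb t tI) (Lb t tI)
    (Lr' t tI) (Lb' t tI) (Lb' t tI).
  have {}fr : \forall x \ae mu, `|vr t x - vr' t x| <= L * E t.
    have : \forall x \ae mu, `|flux K Dr (r t) (b t) (r t) x -
        flux K Dr (r' t) (b' t) (r' t) x| <= L * E t.
      apply: fr.
      - by apply: filterS2 Br Bb => x ? ?; split.
      - by apply: aeW => x; have [? ?] := box2' x; split.
      - by apply: filterS2 (E_r t tI) (E_b t tI) => x ? ?; split.
    by apply: filterS3 er er' => x e1 e1'; rewrite e1 // e1'.
  have {}fb : \forall x \ae mu, `|vb t x - vb' t x| <= L * E t.
    have : \forall x \ae mu, `|flux K Db (r t) (b t) (b t) x -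
        flux K Db (r' t) (b' t) (b' t) x| <= L * E t.
      apply: fb.
      - by apply: filterS2 Br Bb => x ? ?; split.
      - by apply: aeW => x; have [? ?] := box2' x; split.
      - by apply: filterS2 (E_r t tI) (E_b t tI) => x ? ?; split.
    by apply: filterS3 eb eb' => x e1 e1'; rewrite e1 // e1'.
  rewrite lerBlDl; apply: E_le.
    near=> x.
    apply: (ler_norm_backward_step (a := r s x) (a' := r' s x) (v := vr t x) (v' := vr' t x) st);
      near: x => //; exact: E_r.
  near=> x.
  apply: (ler_norm_backward_step (a := b s x) (a' := b' s x) (v := vb t x) (v' := vb' t x) st);
    near: x => //; exact: E_b.
Unshelve. all: by end_near.
Qed.

End uniqueness.

Theorem theorem3p4 (R : realType) (N : nat) (N_ge1 : (1 <= N)%N)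
    (Cr Cb Crr Crb Cbr Cbb : R)
    (Cr_gt0 : 0 < Cr) (Cb_gt0 : 0 < Cb) (Crr_gt0 : 0 < Crr)
    (Crb_gt0 : 0 < Crb) (Cbr_gt0 : 0 < Cbr) (Cbb_gt0 : 0 < Cbb)
    (K1 : 'rV[R]_N -> R) (K1_adm : admissible K1)
    (rI bI : 'rV[R]_N -> R) (I_Mbar : phaseMbar (rI, bI)) :
  let solution :=
    is_solution K1 (mobility_r Cr Crr Crb) (mobility_b Cb Cbr Cbb) rI bI in
  forall T : R, 0 < T ->
    [/\ exists r b, solution T r b,
        forall r b, solution T r b ->
          forall t : R, 0 <= t <= T -> phaseMbar (r t, b t) &
        forall r b r' b', solution T r b -> solution T r' b' ->
          forall t : R, 0 <= t <= T ->
            r t = r' t %[ae torus_measure] /\ b t = b' t %[ae torus_measure]].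
Proof.
move=> solution T T0.
have [mr [lr [mr0 lr0 tr]]] := tame_exponential (- Crr) Crb Cr_gt0.
have [mb [lb [mb0 lb0 tb]]] := tame_exponential Cbr (- Cbb) Cb_gt0.
pose m := mr + mb; pose l := lr + lb.
have m0 : 0 <= m by rewrite addr_ge0.
have l0 : 0 <= l by rewrite addr_ge0.
have tDr : tame_mobility m l (mobility_r Cr Crr Crb).
  by apply: tame_weaken tr; rewrite ?lerDl.
have tDb : tame_mobility m l (mobility_b Cb Cbr Cbb).
  rewrite (_ : mobility_b _ _ _ = fun p q => Cb * expR (Cbr * p + - Cbb * q)).
    by apply: tame_weaken tb; rewrite ?lerDr.
  by apply/funext => p; apply/funext => q; rewrite /mobility_b mulNr.
have iK := admissible_integrable K1_adm.
have [LrI LbI _] := I_Mbar.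
have [rg [bg [good inside]]] := simplex_solution N_ge1 iK
  (fun y => admissible_ge0 K1_adm) m0 l0 tDr tDb LrI LbI (phaseMbar_simplex I_Mbar) T0.
have unique r b : solution T r b -> forall t, 0 <= t <= T ->
    r t = rg t %[ae torus_measure] /\ b t = bg t %[ae torus_measure].
  by move=> sol; exact: (solution_unique iK m0 l0 tDr tDb sol good inside).
split.
- by exists rg, bg.
- move=> r b sol t tT; have [er eb] := unique r b sol t tT.
  have tI : `[0, T]%classic t by rewrite /= in_itv.
  case: sol => -[Lr _] [Lb _] _ _.
  apply: simplex_phaseMbar; [exact/torusLy_L2/Lr|exact/torusLy_L2/Lb|].
  apply: filterS2 er eb => x erx ebx; rewrite erx // ebx //; exact: inside.
- move=> r b r' b' sol sol' t tT.
  have [e1 e2] := unique r b sol t tT; have [e1' e2'] := unique r' b' sol' t tT.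
  split; [apply: filterS2 e1 e1'|apply: filterS2 e2 e2'];
  by move=> x h h' _; rewrite h // h'.
Qed.
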